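(* Consider the iterates of the C-GT algorithm (defined in the context) applied to $f=\frac1n\sum_{i=1}^n f_i$, where the network, the weight matrix $W$, the functions $f_i$ and the compression operator $\mathcal{C}$ (with constants $C\ge 0$, $r>0$, $\delta\in(0,1]$) satisfy the assumptions listed in the context. Let the scaling parameters satisfy $\alpha_x,\alpha_y\in(0,\frac1r]$. Let $\epsilon_1,\dots,\epsilon_5>0$ satisfy $$n\epsilon_1\ge 3\kappa^2\epsilon_2,\qquad \epsilon_2\ge 2c_1c_2\epsilon_4,\qquad \epsilon_3\ge \frac{4m_2}{s},\qquad \epsilon_4>0,\qquad \epsilon_5>0,$$ let the consensus step-size $\gamma>0$ satisfy $$\gamma\le\min\Big\{1,\ \frac{1-c_x}{m_3}\epsilon_4,\ \frac{1-c_y}{m_4}\epsilon_5\Big\},$$ and let the fixed step-size $\eta>0$ satisfy $$\eta\le\min\Big\{\frac{s\epsilon_2}{4\kappa\epsilon_3}\frac{\gamma}{L},\ \frac{s\epsilon_3}{12\kappa(2n\epsilon_1+2\epsilon_2+\epsilon_3)}\frac{\gamma}{L}\Big\}.$$ Here $s,\kappa,c_1,c_2,c_x,c_y,m_2,m_3,m_4$ and the $5\times5$ matrix $A$ are defined in the context. Then the spectral radius of $A$ satisfies $\rho(A)\le 1-\frac12\eta\mu$, and hence the optimization error $\Omega_o^k=\mathbb{E}\big[\|\overline{X}^k-x^*\|^2\big]$ and the consensus error $\Omega_c^k=\mathbb{E}\big[\|X^k-\mathbf{1}\overline{X}^k\|^2\big]$ both converge to $0$ at the linear rate $\mathcal{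O}\big((1-\frac12\eta\mu)^k\big)$.
   Context: Notation. $\|\cdot\|$ is the Frobenius norm for vectors and for $n\times p$ matrices and the spectral norm for square matrices; $\mathbf 1\in\mathbb{R}^n$ is the all-ones column vector. For $X\in\mathbb{R}^{n\times p}$ with rows $x_1^{\top},\dots,x_n^{\top}$ put $\overline X=\frac1n\mathbf 1^{\top}X\in\mathbb{R}^{1\times p}$ and $\nabla F(X)=[\nabla f_1(x_1),\dots,\nabla f_n(x_n)]^{\top}\in\mathbb{R}^{n\times p}$. Network. $n$ agents are connected by a strongly connected directed graph with a nonnegative doubly stochastic weight matrix $W=[w_{ij}]\in\mathbb{R}^{n\times n}$ ($W\mathbf 1=\mathbf 1$, $\mathbf 1^{\top}W=\mathbf 1^{\top}$), where agent $i$ can receive information from agent $j$ iff $w_{ij}>0$. Let $\rho_w$ be the spectral norm of $W-\frac1n\mathbf 1\mathbf 1^{\top}$; it holds that $\rho_w<1$. Put $s=1-\rho_w$ and $\tilde\rho=1-\gamma s$. Objective. $f_i:\mathbb{R}^p\to\mathbb{R}$ are differentiable, $f=\frac1n\sum_i f_i$ is $\mu$-strongly convex ($\langle\nabla f(x)-\nabla f(x'),x-x'\rangle\ge\mu\|x-x'\|^2$, $\mu>0$), and each $\nabla f_i$ is $L_i$-Lipschitz; $L=\max_i L_i$, $\kappa=L/\mu$. $x^*\in\mathbb{R}^{1\times p}$ is the unique minimizer of $f$ (as a row vector). Compression. The (possibly random) operator $\mathcal C:\mathbb{R}^p\to\mathbb{R}^p$ satisfies, for all $x$, $\mathbb{E}\|\mathcal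 C(x)-x\|^2\le C\|x\|^2$ and $\mathbb{E}\|\frac{\mathcal C(x)}{r}-x\|^2\le(1-\delta)\|x\|^2$, for constants $C\ge0$, $r>0$, $\delta\in(0,1]$. $\mathrm{Compress}(Z)$ for $Z\in\mathbb{R}^{n\times p}$ applies $\mathcal C$ to each row of $Z$, with internal randomness drawn independently for each agent and at every iteration/call. C-GT algorithm. Given initial values $X^0,H_x^0,H_y^0\in\mathbb{R}^{n\times p}$ and $Y^0=\nabla F(X^0)$, for $k=0,1,2,\dots$: $Q_x^k=\mathrm{Compress}(X^k-H_x^k)$, $\widehat X^k=H_x^k+Q_x^k$, $H_x^{k+1}=(1-\alpha_x)H_x^k+\alpha_x\widehat X^k$; $Q_y^k=\mathrm{Compress}(Y^k-H_y^k)$, $\widehat Y^k=H_y^k+Q_y^k$, $H_y^{k+1}=(1-\alpha_y)H_y^k+\alpha_y\widehat Y^k$; $X^{k+1}=X^k-\gamma(I-W)\widehat X^k-\eta Y^k$; $Y^{k+1}=Y^k-\gamma(I-W)\widehat Y^k+\nabla F(X^{k+1})-\nabla F(X^k)$. Constants. Fix $\tau_x,\tau_y>1$ such that $c_x:=\tau_x(1-\alpha_x r\delta)<1$ and $c_y:=\tau_y(1-\alpha_y r\delta)<1$ (possible since $0<\alpha_x r,\alpha_y r\le1$), and put $t_x=\frac{3\tau_x}{\tau_x-1}$, $t_y=\frac{3\tau_y}{\tau_y-1}$, $c_1=\frac2s$, $c_2=\frac{2C}{s}\|I-W\|^2$, $c_3=\frac{12L^2}{s}$, $c_4=\frac6s\|I-W\|^2$,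 $c_5=t_x\|I-W\|^2$, $c_6=t_xC\|I-W\|^2$, $c_7=t_yC\|I-W\|^2$, $c_8=t_y\|I-W\|^2$; $m_2=c_4\epsilon_2+c_2(3\epsilon_4+\epsilon_5)$, $m_3=t_x(2n\epsilon_1+2\epsilon_2+\epsilon_3)+c_5\epsilon_2+c_6\epsilon_4+\frac{\epsilon_4}{2\kappa}$, $m_4=3t_y(2n\epsilon_1+2\epsilon_2+\epsilon_3)+3c_8\epsilon_2+c_8\epsilon_3+3c_7\epsilon_4+c_7\epsilon_5+\frac{\epsilon_5}{2\kappa}$. Matrix $A$ (the transition matrix of a component-wise inequality $w^{k+1}\le Aw^k$ for $w^k=[\Omega_o^k,\Omega_c^k,\Omega_g^k,\Omega_{cx}^k,\Omega_{cy}^k]^{\top}$, with $\Omega_o^k,\Omega_c^k$ as in the claim, $\Omega_g^k=\mathbb{E}\|Y^k-\mathbf 1\overline Y^k\|^2$, $\Omega_{cx}^k=\mathbb{E}\|X^k-H_x^k\|^2$, $\Omega_{cy}^k=\mathbb{E}\|Y^k-H_y^k\|^2$): $$A=\begin{bmatrix}1-\frac32\eta\mu&\frac{3\eta L^2}{\mu n}&0&0&0\\0&\frac{1+\tilde\rho^2}{2}&c_1\frac{\eta^2}{\gamma}&c_2\gamma&0\\ nc_3L^2\frac{\eta^2}{\gamma}&c_3L^2\frac{\eta^2}{\gamma}+c_4L^2\gamma&\frac{1+\tilde\rho^2}{2}+\frac12c_3\frac{\eta^2}{\gamma}&3c_2L^2\gamma&c_2\gamma\\2nt_xL^2\eta^2&c_5\gamma^2+2t_xL^2\eta^2&t_x\eta^2&c_x+c_6\gamma^2&0\\6nt_yL^4\eta^2&3c_8L^2\gamma^2+6t_yL^4\eta^2&3t_yL^2\eta^2+c_8\gamma^2&3c_7L^2\gamma^2&c_y+c_7\gamma^2\end{bmatrix}.$$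 *)

(* Defs.v *)
From HB Require Import structures.
From mathcomp Require Export all_boot all_order all_algebra.
From mathcomp Require Export all_classical all_reals all_analysis.
From mathcomp Require Export complex.

Set Implicit Arguments.
Unset Strict Implicit.
Unset Printing Implicit Defensive.

Export Order.TTheory GRing.Theory Num.Theory numFieldNormedType.Exports.

Local Open Scope classical_set_scope.
Local Open Scope ring_scope.

(* [`|A|] is the entrywise maximum norm in the library, hence the norms below. *)
Definition frob (R : realType) (m n : nat) (A : 'M[R]_(m, n)) : R :=
  Num.sqrt (\sum_i \sum_j A i j ^+ 2).

Definition spectral_norm (R : realType) (n : nat) (A : 'M[R]_n) : R :=
  sup [set frob (A *m v) | v in [set v : 'cV[R]_n | frob v <= 1]].

(* The eigenvalues are the complex ones. *)
Definition spectral_radius (R : realType) (n : nat) (A : 'M[R]_n) : R :=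
  sup [set ComplexField.Normc.normc l |
       l in [set l : R[i] | eigenvalue (map_mx (real_complex R) A) l]].

Definition inner (R : realType) (p : nat) (u v : 'rV[R]_p) : R :=
  \sum_j u 0 j * v 0 j.

Definition grad (R : realType) (p : nat) (f : 'rV[R]_p -> R) (x : 'rV[R]_p) :
    'rV[R]_p :=
  \row_j 'D_(delta_mx 0 j) f x.

Definition strongly_convex (R : realType) (p : nat) (mu : R)
    (f : 'rV[R]_p -> R) : Prop :=
  forall x y, mu * frob (x - y) ^+ 2 <= inner (grad f x - grad f y) (x - y).

Definition lipschitz_grad (R : realType) (p : nat) (K : R)
    (f : 'rV[R]_p -> R) : Prop :=
  forall x y, frob (grad f x - grad f y) <= K * frob (x - y).

Definition average (R : realType) (n p : nat) (f : 'I_n -> 'rV[R]_p -> R) :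
    'rV[R]_p -> R :=
  fun x => n%:R^-1 * \sum_i f i x.

Definition unique_minimizer (R : realType) (p : nat) (f : 'rV[R]_p -> R)
    (x : 'rV[R]_p) : Prop :=
  [set y | forall z, f y <= f z] = [set x].

Definition doubly_stochastic (R : realType) (n : nat) (W : 'M[R]_n) : Prop :=
  [/\ forall i j, 0 <= W i j,
      W *m const_mx 1 = const_mx 1 :> 'cV[R]_n &
      const_mx 1 *m W = const_mx 1 :> 'rV[R]_n].

(* The edge j -> i is present when agent i receives from agent j. *)
Definition comm_graph (R : realType) (n : nat) (W : 'M[R]_n) : rel 'I_n :=
  fun j i => 0 < W i j.

Definition strongly_connected (n : nat) (e : rel 'I_n) : Prop :=
  forall i j, connect e i j.

Definition row_mean (R : realType) (n p : nat) (X : 'M[R]_(n, p)) : 'rV[R]_p :=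
  n%:R^-1 *: (const_mx 1 *m X).

(* The n x p matrix X - 1 Xbar. *)
Definition deviation (R : realType) (n p : nat) (X : 'M[R]_(n, p)) :
    'M[R]_(n, p) :=
  X - (const_mx 1 : 'cV[R]_n) *m row_mean X.

Definition stacked_grad (R : realType) (n p : nat)
    (f : 'I_n -> 'rV[R]_p -> R) (X : 'M[R]_(n, p)) : 'M[R]_(n, p) :=
  \matrix_(i, j) grad (f i) (row i X) 0 j.

(* R^p with its Borel sigma-algebra. *)
Definition borel_rV (R : realType) (p : nat) :=
  g_sigma_algebraType (@open 'rV[R]_p).

(* A random operator on R^p is a map [cop] that also takes a random seed of law
   [nu]. Joint measurability gives a meaning to the compression of a random
   vector. *)
Definition compressor (R : realType) (p : nat) (d : measure_display)
    (Xi : measurableType d) (nu : probability Xi R)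
    (C r delta : R) (cop : Xi -> 'rV[R]_p -> 'rV[R]_p) : Prop :=
  [/\ measurable_fun [set: Xi * borel_rV R p]
        (fun z => cop z.1 z.2 : borel_rV R p),
      forall x, ('E_nu[fun z => (frob (cop z x - x) ^+ 2)%R] <=
                 (C * frob x ^+ 2)%:E)%E &
      forall x, ('E_nu[fun z => (frob (r^-1 *: cop z x - x) ^+ 2)%R] <=
                 ((1 - delta) * frob x ^+ 2)%:E)%E].

Definition mutually_independent (R : realType) (d d' : measure_display)
    (Omega : measurableType d) (P : probability Omega R)
    (Xi : measurableType d') (I : choiceType)
    (xi : I -> {RV P >-> Xi}) : Prop :=
  forall (J : seq I) (A : I -> set Xi), uniq J ->
    (forall i, measurable (A i)) ->
    P (\bigcap_(i in [set` J]) (xi i @^-1` A i)) =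
    (\prod_(i <- J) P (xi i @^-1` A i))%E.

Definition iid (R : realType) (d d' : measure_display)
    (Omega : measurableType d) (P : probability Omega R)
    (Xi : measurableType d') (nu : probability Xi R) (I : choiceType)
    (xi : I -> {RV P >-> Xi}) : Prop :=
  mutually_independent xi /\
  forall i (A : set Xi), measurable A -> distribution P (xi i) A = nu A.

Definition compress (R : realType) (n p : nat) (Xi : Type)
    (cop : Xi -> 'rV[R]_p -> 'rV[R]_p) (z : 'I_n -> Xi) (Z : 'M[R]_(n, p)) :
    'M[R]_(n, p) :=
  \matrix_(i, j) cop (z i) (row i Z) 0 j.

Record cgt_state (R : realType) (n p : nat) := CGTState {
  st_X : 'M[R]_(n, p);
  st_Hx : 'M[R]_(n, p);
  st_Y : 'M[R]_(n, p);
  st_Hy : 'M[R]_(n, p)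
}.

(* [zx i] and [zy i] are the seeds used by agent i in the two compressions. *)
Definition cgt_step (R : realType) (n p : nat) (Xi : Type)
    (f : 'I_n -> 'rV[R]_p -> R) (W : 'M[R]_n)
    (cop : Xi -> 'rV[R]_p -> 'rV[R]_p) (alphax alphay gamma eta : R)
    (zx zy : 'I_n -> Xi) (st : cgt_state R n p) : cgt_state R n p :=
  let: CGTState X Hx Y Hy := st in
  let Xhat := Hx + compress cop zx (X - Hx) in
  let Yhat := Hy + compress cop zy (Y - Hy) in
  let X' := X - gamma *: ((1%:M - W) *m Xhat) - eta *: Y in
  let Y' := Y - gamma *: ((1%:M - W) *m Yhat)
            + stacked_grad f X' - stacked_grad f X in
  CGTState X' ((1 - alphax) *: Hx + alphax *: Xhat)
           Y' ((1 - alphay) *: Hy + alphay *: Yhat).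

(* The state at iteration k on the outcome w. The seed of agent i at iteration
   k is [xi (true, k, i)] in the compression of X - Hx and [xi (false, k, i)] in
   that of Y - Hy. *)
Fixpoint cgt (R : realType) (n p : nat) (Xi Omega : Type)
    (f : 'I_n -> 'rV[R]_p -> R) (W : 'M[R]_n)
    (cop : Xi -> 'rV[R]_p -> 'rV[R]_p) (alphax alphay gamma eta : R)
    (xi : bool * nat * 'I_n -> Omega -> Xi) (X0 Hx0 Hy0 : 'M[R]_(n, p))
    (k : nat) (w : Omega) : cgt_state R n p :=
  if k is k'.+1 then
    cgt_step f W cop alphax alphay gamma eta
      (fun i => xi (true, k', i) w) (fun i => xi (false, k', i) w)
      (cgt f W cop alphax alphay gamma eta xi X0 Hx0 Hy0 k' w)
  else CGTState X0 Hx0 (stacked_grad f X0) Hy0.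

Definition mx_of_rows (R : realType) (m n : nat) (rows : seq (seq R)) :
    'M[R]_(m, n) :=
  \matrix_(i, j) (nth [::] rows i)`_j.

(* Main.v *)
Require Import Defs.
From mathcomp Require Import measurable_realfun ring lra.

(** Five errors are followed along the iterations: the distance of the mean iterate to
    the minimizer, the deviations of [X] and [Y] from their means over the agents, and
    the distances of [X] and [Y] to their compression states.

    Outcome by outcome, each new error is at most a nonnegative combination of the old
    ones and of the squared errors of the two compressions.  Gossip preserves means
    ([tracking_step]) and contracts deviations by [1 - gamma s]
    ([gossip_contraction]), so that [perturbed_gossip] handles both deviations; the mean
    iterate performs a gradient step on the average objective, perturbed by the
    deviation ([optimality_step]); a compression state moves towards its target by a
    convex combination ([compression_step]).

    The seeds used at iteration [k] are independent of the state at iteration [k],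
    which depends only on earlier seeds.  The joint law of a fresh seed and of the past
    is therefore a product measure, and Tonelli's theorem turns the mean square bounds
    on the compression of a fixed vector into bounds on the compression of the random
    state ([integral_fresh_seed], [moment_compress]).  Taking expectations gives the
    component-wise recursion with the nonnegative matrix [A].

    The step-size conditions imply that [A v <= (1 - eta mu / 2) v] for the
    positive vector [v = (eps1, eps2, L^2 eps3, eps4, L^2 eps5)] (the lemmas [row_...]).
    This single inequality has two consequences.  Weighting the entries of a left
    eigenvector by [v] bounds the spectral radius of [A] ([spectral_radius_le]); and if
    the errors are at most [K v] at some iteration, they are at most
    [K (1 - eta mu / 2) v] at the next one, whence the linear rate ([moments_decay]).
    The initial state is deterministic, so such a [K] exists at the start. *)

Set Implicit Arguments.
Unset Strict Implicit.
Unset Printing Implicit Defensive.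

Local Open Scope classical_set_scope.
Local Open Scope ring_scope.

(** * Frobenius and spectral norms, averaging over the agents *)

Section Frobenius.
Context {R : realType}.

Definition dotmx m n (A B : 'M[R]_(m, n)) : R := \sum_i \sum_j A i j * B i j.

Lemma frob_ge0 m n (A : 'M[R]_(m, n)) : 0 <= frob A.
Proof. exact: sqrtr_ge0. Qed.

Lemma sqr_frob m n (A : 'M[R]_(m, n)) : frob A ^+ 2 = \sum_i \sum_j A i j ^+ 2.
Proof.
rewrite sqr_sqrtr// sumr_ge0// => i _; apply: sumr_ge0 => j _; exact: sqr_ge0.
Qed.

Lemma dotmxx m n (A : 'M[R]_(m, n)) : dotmx A A = frob A ^+ 2.
Proof. by rewrite sqr_frob. Qed.

Lemma dotmxDl m n (A B D : 'M[R]_(m, n)) : dotmx (A + B) D = dotmx A D + dotmx B D.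
Proof.
rewrite -big_split; apply: eq_bigr => i _; rewrite -big_split; apply: eq_bigr => j _.
by rewrite mxE mulrDl.
Qed.

Lemma dotmxC m n (A B : 'M[R]_(m, n)) : dotmx A B = dotmx B A.
Proof. by apply: eq_bigr => i _; apply: eq_bigr => j _; rewrite mulrC. Qed.

Lemma dotmxZl m n a (A D : 'M[R]_(m, n)) : dotmx (a *: A) D = a * dotmx A D.
Proof.
rewrite mulr_sumr; apply: eq_bigr => i _; rewrite mulr_sumr; apply: eq_bigr => j _.
by rewrite mxE mulrA.
Qed.

Lemma dotmxZr m n a (A D : 'M[R]_(m, n)) : dotmx A (a *: D) = a * dotmx A D.
Proof. by rewrite dotmxC dotmxZl dotmxC. Qed.

Lemma sqr_frobD m n (A B : 'M[R]_(m, n)) :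
  frob (A + B) ^+ 2 = frob A ^+ 2 + 2 * dotmx A B + frob B ^+ 2.
Proof.
rewrite -!dotmxx dotmxDl (dotmxC A) (dotmxC B) !dotmxDl (dotmxC B A); ring.
Qed.

Lemma frobZ m n a (A : 'M[R]_(m, n)) : frob (a *: A) = `|a| * frob A.
Proof.
apply/eqP; rewrite -(@eqrXn2 _ 2)// ?mulr_ge0 ?frob_ge0//.
by rewrite -dotmxx dotmxZl dotmxZr dotmxx exprMn real_normK ?num_real// expr2 mulrA.
Qed.

Lemma frobN m n (A : 'M[R]_(m, n)) : frob (- A) = frob A.
Proof. by rewrite -scaleN1r frobZ normrN1 mul1r. Qed.

Lemma frob_eq0 m n (A : 'M[R]_(m, n)) : frob A = 0 -> A = 0.
Proof.
move=> A0; have := sqr_frob A; rewrite A0 expr0n/= => /esym/eqP.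
rewrite psumr_eq0 => [|i _]; last by apply: sumr_ge0 => j _; exact: sqr_ge0.
move=> /allP S; apply/matrixP => i j; rewrite mxE.
have := S i (mem_index_enum i); rewrite implyTb.
rewrite psumr_eq0 => [|k _]; last exact: sqr_ge0.
by move=> /allP/(_ j (mem_index_enum j)); rewrite implyTb sqrf_eq0 => /eqP.
Qed.

(** Nonnegativity of the square of [|B|^2 A - <A, B> B]. *)
Lemma dotmx_le m n (A B : 'M[R]_(m, n)) : dotmx A B <= frob A * frob B.
Proof.
have [B0|B0] := eqVneq (frob B) 0.
  rewrite B0 mulr0 (frob_eq0 B0) -(scale0r (0 : 'M[R]_(m, n))) dotmxZr mul0r//.
have [neg|c0] := ltP (dotmx A B) 0.
  by rewrite (le_trans (ltW neg))// mulr_ge0 ?frob_ge0.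
have Bp : 0 < frob B by rewrite lt_neqAle eq_sym B0 frob_ge0.
rewrite -(@ler_pXn2r _ 2)// ?nnegrE ?mulr_ge0 ?frob_ge0//.
have := sqr_ge0 (frob (frob B ^+ 2 *: A + (- dotmx A B) *: B)).
rewrite sqr_frobD !frobZ !exprMn !real_normK ?num_real// dotmxZl dotmxZr.
have B2 : 0 < frob B ^+ 2 by rewrite exprn_gt0.
set b := frob B ^+ 2; set c := dotmx A B; set a := frob A ^+ 2 => H.
rewrite -(ler_pM2l B2) -/b; move: H; lra.
Qed.

Lemma frobD m n (A B : 'M[R]_(m, n)) : frob (A + B) <= frob A + frob B.
Proof.
rewrite -(@ler_pXn2r _ 2)// ?nnegrE ?addr_ge0 ?frob_ge0// sqr_frobD.
have := dotmx_le A B; lra.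
Qed.

Lemma sqr_frob_row m n (A : 'M[R]_(m, n)) :
  frob A ^+ 2 = \sum_i frob (row i A) ^+ 2.
Proof.
rewrite sqr_frob; apply: eq_bigr => i _; rewrite sqr_frob big_ord1.
by apply: eq_bigr => j _; rewrite mxE.
Qed.

Lemma sqr_frob_col m n (A : 'M[R]_(m, n)) :
  frob A ^+ 2 = \sum_j frob (col j A) ^+ 2.
Proof.
rewrite sqr_frob exchange_big; apply: eq_bigr => j _; rewrite sqr_frob.
by apply: eq_bigr => i _; rewrite big_ord1 mxE.
Qed.

Lemma le_frob_entry m n (A : 'M[R]_(m, n)) i j : `|A i j| <= frob A.
Proof.
rewrite -(@ler_pXn2r _ 2)// ?nnegrE ?frob_ge0// real_normK ?num_real//.
rewrite sqr_frob (bigD1 i)//= (bigD1 j)//= -addrA lerDl addr_ge0//.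
  by apply: sumr_ge0 => k _; exact: sqr_ge0.
by apply: sumr_ge0 => k _; apply: sumr_ge0 => l _; exact: sqr_ge0.
Qed.

Lemma le_frobM m n p (A : 'M[R]_(m, n)) (B : 'M[R]_(n, p)) :
  frob (A *m B) <= frob A * frob B.
Proof.
rewrite -(@ler_pXn2r _ 2)// ?nnegrE ?mulr_ge0 ?frob_ge0// exprMn.
rewrite sqr_frob [frob A ^+ 2]sqr_frob_row mulr_suml ler_sum// => i _.
rewrite [frob B ^+ 2]sqr_frob_col mulr_sumr ler_sum// => j _.
have -> : (A *m B) i j = dotmx (row i A) (col j B)^T.
  by rewrite /dotmx big_ord1 mxE; apply: eq_bigr => k _; rewrite !mxE.
have <- : frob (col j B)^T = frob (col j B).
  rewrite /frob; congr Num.sqrt; rewrite exchange_big/=.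
  by apply: eq_bigr => k _; apply: eq_bigr => l _; rewrite !mxE.
rewrite -exprMn -real_normK ?num_real// ler_pXn2r ?nnegrE ?mulr_ge0 ?frob_ge0//.
rewrite ler_norml dotmx_le andbT lerNl -(frobN (row i A)) -[X in - X]mul1r -mulNr.
by rewrite -dotmxZl scaleN1r dotmx_le.
Qed.

Lemma spectral_norm_has_sup n (A : 'M[R]_n) :
  has_sup [set frob (A *m v) | v in [set v : 'cV[R]_n | frob v <= 1]].
Proof.
split.
  exists (frob (A *m (0 : 'cV[R]_n))), (0 : 'cV[R]_n) => //=.
  by rewrite -(scale0r (0 : 'cV[R]_n)) frobZ normr0 mul0r.
exists (frob A) => _ [v /= v1 <-]; rewrite (le_trans (le_frobM _ _))//.
by rewrite ler_piMr ?frob_ge0.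
Qed.

Lemma spectral_norm_ge0 n (A : 'M[R]_n) : 0 <= spectral_norm A.
Proof.
have [_ ub] := spectral_norm_has_sup A.
apply: (@le_trans _ _ (frob (A *m (0 : 'cV[R]_n)))); first exact: frob_ge0.
apply: (ub_le_sup ub); exists 0 => //=.
by rewrite -(scale0r (0 : 'cV[R]_n)) frobZ normr0 mul0r.
Qed.

Lemma frob_spectral_cV n (A : 'M[R]_n) (v : 'cV[R]_n) :
  frob (A *m v) <= spectral_norm A * frob v.
Proof.
have [_ ub] := spectral_norm_has_sup A.
have [v0|v0] := eqVneq (frob v) 0.
  rewrite v0 mulr0 (frob_eq0 v0) mulmx0 -(scale0r (0 : 'cV[R]_n)) frobZ normr0.
  by rewrite mul0r.
have vp : 0 < frob v by rewrite lt_neqAle eq_sym v0 frob_ge0.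
rewrite -ler_pdivrMr// mulrC.
have -> : (frob v)^-1 * frob (A *m v) = frob (A *m ((frob v)^-1 *: v)).
  by rewrite -scalemxAr frobZ gtr0_norm ?invr_gt0.
apply: (ub_le_sup ub); exists ((frob v)^-1 *: v) => //=.
by rewrite frobZ gtr0_norm ?invr_gt0// mulVf.
Qed.

(** Squared Frobenius norms add up over the columns, and each column obeys the bound
    for vectors. *)
Lemma frob_spectral n p (A : 'M[R]_n) (B : 'M[R]_(n, p)) :
  frob (A *m B) <= spectral_norm A * frob B.
Proof.
rewrite -(@ler_pXn2r _ 2)// ?nnegrE ?mulr_ge0 ?frob_ge0 ?spectral_norm_ge0//.
rewrite exprMn !sqr_frob_col mulr_sumr ler_sum// => j _.
rewrite colE -mulmxA -colE -exprMn ler_pXn2r ?nnegrE ?mulr_ge0 ?frob_ge0 ?spectral_norm_ge0//.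
exact: frob_spectral_cV.
Qed.

End Frobenius.

Section Averaging.
Context {R : realType} {n p : nat}.
Hypothesis n_gt0 : (0 < n)%N.

Let J : 'M[R]_n := n%:R^-1 *: const_mx 1.
Let nR : (n%:R : R) != 0. Proof. by rewrite pnatr_eq0 -lt0n. Qed.

Lemma const_row_mean (X : 'M[R]_(n, p)) :
  (const_mx 1 : 'cV[R]_n) *m row_mean X = J *m X.
Proof.
rewrite /row_mean -scalemxAr -scalemxAl mulmxA; congr (_ *: (_ *m _)).
by apply/matrixP => i j; rewrite !mxE big_ord1 !mxE mulr1.
Qed.

Lemma deviationE (X : 'M[R]_(n, p)) : deviation X = (1%:M - J) *m X.
Proof. by rewrite /deviation const_row_mean mulmxBl mul1mx. Qed.

Lemma row_meanE (X : 'M[R]_(n, p)) : row_mean X = n%:R^-1 *: \sum_i row i X.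
Proof.
congr (_ *: _); apply/matrixP => i j; rewrite ord1 !mxE summxE.
by apply: eq_bigr => k _; rewrite !mxE mul1r.
Qed.

Lemma row_deviation (X : 'M[R]_(n, p)) i : row i (deviation X) = row i X - row_mean X.
Proof.
rewrite /deviation; apply/matrixP => k j; rewrite !mxE big_ord1 !mxE mul1r.
by congr (_ - _ * _); apply: eq_bigr => l _; rewrite !mxE.
Qed.

Lemma row_meanD (X Y : 'M[R]_(n, p)) : row_mean (X + Y) = row_mean X + row_mean Y.
Proof. by rewrite /row_mean mulmxDr scalerDr. Qed.

Lemma row_meanZ a (X : 'M[R]_(n, p)) : row_mean (a *: X) = a *: row_mean X.
Proof. by rewrite /row_mean -scalemxAr !scalerA mulrC. Qed.

Lemma row_meanB (X Y : 'M[R]_(n, p)) : row_mean (X - Y) = row_mean X - row_mean Y.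
Proof. by rewrite row_meanD -scaleN1r row_meanZ scaleN1r. Qed.

(** Pythagoras: the rows of the deviation sum to zero, so the deviation is orthogonal
    to the matrix whose rows all equal the mean. *)
Lemma sqr_frob_deviation (X : 'M[R]_(n, p)) :
  frob X ^+ 2 = frob (deviation X) ^+ 2 + n%:R * frob (row_mean X) ^+ 2.
Proof.
rewrite [in LHS]sqr_frob_row [frob (deviation X) ^+ 2]sqr_frob_row.
have E i : frob (row i X) ^+ 2 =
    frob (row i (deviation X)) ^+ 2 + 2 * dotmx (row i (deviation X)) (row_mean X)
    + frob (row_mean X) ^+ 2.
  by rewrite -sqr_frobD row_deviation subrK.
under eq_bigr do rewrite E.
rewrite !big_split/= sumr_const card_ord -[_ *+ n]mulr_natl; congr (_ + _).
rewrite -[RHS]addr0; congr (_ + _); rewrite -mulr_sumr.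
have -> : \sum_i dotmx (row i (deviation X)) (row_mean X) =
          dotmx (\sum_i row i (deviation X)) (row_mean X).
  rewrite (big_morph (fun Y : 'rV[R]_p => dotmx Y (row_mean X)) (id1 := 0)
    (op1 := +%R) _)//.
    by move=> A B; exact: dotmxDl.
  by rewrite -(scale0r (0 : 'rV[R]_p)) dotmxZl mul0r.
have -> : \sum_i row i (deviation X) = 0.
  under eq_bigr do rewrite row_deviation.
  rewrite sumrB sumr_const card_ord -scaler_nat [X in _ *: X]row_meanE scalerA.
  by rewrite mulfV// scale1r subrr.
by rewrite -(scale0r (0 : 'rV[R]_p)) dotmxZl mul0r mulr0.
Qed.

Lemma frob_deviation_le (X : 'M[R]_(n, p)) : frob (deviation X) <= frob X.
Proof.
rewrite -(@ler_pXn2r _ 2)// ?nnegrE ?frob_ge0// [leRHS]sqr_frob_deviation.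
by rewrite lerDl mulr_ge0 ?sqr_ge0.
Qed.

Variable W : 'M[R]_n.
Hypothesis W_stoch : doubly_stochastic W.

Let mulJW : J *m W = J.
Proof.
case: W_stoch => _ _ W1; rewrite /J -scalemxAl; congr (_ *: _).
apply/matrixP => i j; move/matrixP: W1 => /(_ 0 j); rewrite !mxE => E; rewrite -[RHS]E.
by apply: eq_bigr => k _; rewrite !mxE.
Qed.

Let mulWJ : W *m J = J.
Proof.
case: W_stoch => _ W1 _; rewrite /J -scalemxAr; congr (_ *: _).
apply/matrixP => i j; move/matrixP: W1 => /(_ i 0); rewrite !mxE => E; rewrite -[RHS]E.
by apply: eq_bigr => k _; rewrite !mxE.
Qed.

Let mulJJ : J *m J = J.
Proof.
rewrite {1 3}/J -scalemxAl; congr (_ *: _); apply/matrixP => i j; rewrite !mxE.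
under eq_bigr do rewrite !mxE mulr1 mul1r.
by rewrite sumr_const card_ord -[_ *+ n]mulr_natl mulfV.
Qed.

Lemma deviation_laplacian (Z : 'M[R]_(n, p)) :
  deviation ((1%:M - W) *m Z) = (1%:M - W) *m Z.
Proof.
have E : (1%:M - J) *m (1%:M - W) = 1%:M - W.
  by rewrite mulmxBl mul1mx mulmxBr mulmx1 mulJW subrr subr0.
by rewrite deviationE mulmxA E.
Qed.

Lemma laplacian_deviation (Z : 'M[R]_(n, p)) :
  (1%:M - W) *m deviation Z = (1%:M - W) *m Z.
Proof.
have E : (1%:M - W) *m (1%:M - J) = 1%:M - W.
  by rewrite mulmxBr mulmx1 mulmxBl mul1mx mulWJ subrr subr0.
by rewrite deviationE mulmxA E.
Qed.

Lemma row_mean_laplacian (Z : 'M[R]_(n, p)) : row_mean ((1%:M - W) *m Z) = 0.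
Proof.
case: W_stoch => _ _ W1.
by rewrite /row_mean mulmxA mulmxBr mulmx1 W1 subrr mul0mx scaler0.
Qed.

Lemma deviationD (X Y : 'M[R]_(n, p)) : deviation (X + Y) = deviation X + deviation Y.
Proof. by rewrite !deviationE mulmxDr. Qed.

Lemma deviationZ a (X : 'M[R]_(n, p)) : deviation (a *: X) = a *: deviation X.
Proof. by rewrite !deviationE scalemxAr. Qed.

Lemma deviationB (X Y : 'M[R]_(n, p)) : deviation (X - Y) = deviation X - deviation Y.
Proof. by rewrite !deviationE mulmxBr. Qed.

Lemma deviationK (X : 'M[R]_(n, p)) : deviation (deviation X) = deviation X.
Proof.
have E : (1%:M - J) *m (1%:M - J) = 1%:M - J.
  by rewrite mulmxBl mul1mx mulmxBr mulmx1 mulJJ subrr subr0.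
by rewrite !deviationE mulmxA E.
Qed.

(** On deviations, [W] acts as [W - J] where [J] averages the rows; the step is then
    the convex combination, with weight [gamma], of the identity and of [W - J]. *)
Lemma gossip_contraction gamma (Z : 'M[R]_(n, p)) : 0 <= gamma <= 1 ->
  frob (deviation Z - gamma *: ((1%:M - W) *m deviation Z)) <=
  (1 - gamma * (1 - spectral_norm (W - J))) * frob (deviation Z).
Proof.
move=> /andP[g0 g1].
have -> : deviation Z - gamma *: ((1%:M - W) *m deviation Z) =
    (1 - gamma) *: deviation Z + gamma *: ((W - J) *m deviation Z).
  have -> : (W - J) *m deviation Z = W *m deviation Z.
    by rewrite mulmxBl deviationE [J *m _]mulmxA mulmxBr mulJJ mulmx1 subrr mul0mx subr0.
  rewrite mulmxBl mul1mx scalerBl scale1r scalerBr; set A := _ *m _.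
  by rewrite opprB addrA addrAC.
rewrite (le_trans (frobD _ _))// !frobZ !ger0_norm ?subr_ge0//.
have := ler_wpM2l g0 (frob_spectral (W - J) (deviation Z)); lra.
Qed.

End Averaging.

(** * Gradients *)

Section Gradient.
Context {R : realType} {p : nat}.
Implicit Types (g : 'rV[R]_p -> R) (x y v : 'rV[R]_p).

(** The difference quotients of a function at a minimum are nonnegative on the right,
    and differentiability makes the two-sided limit a limit from the right. *)
Lemma derive_at_min_ge0 g x v : differentiable g x -> (forall z, g x <= g z) ->
  0 <= 'D_v g x.
Proof.
move=> gx gmin; have dg : derivable g x v by exact: diff_derivable.
rewrite /derive cvg_at_rightE//; apply: limr_ge.
  rewrite -(cvg_at_rightE (fun h : R => h^-1 *: ((g \o shift x) (h *: v) - g x)))//.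
  apply: cvg_trans dg; apply: cvg_app.
  move=> A [e egt0 Ae]; exists e => // h he hgt0; apply: Ae => //.
  exact/lt0r_neq0.
near=> h; apply: mulr_ge0; last by rewrite subr_ge0 gmin.
by rewrite invr_ge0; apply: ltW; near: h; exists 1 => /=.
Unshelve. all: by end_near. Qed.

(** The one-sided bound holds along a basis vector and along its opposite. *)
Lemma grad_at_min g x : differentiable g x -> (forall z, g x <= g z) ->
  grad g x = 0.
Proof.
move=> gx gmin; apply/matrixP => i j; rewrite !mxE; apply/eqP.
rewrite eq_le derive_at_min_ge0// andbT -oppr_ge0.
have -> : - 'D_(delta_mx 0 j) g x = 'D_(- delta_mx 0 j) g x.
  by rewrite !deriveE// linearN.
exact: derive_at_min_ge0.
Qed.

Context {n : nat} (f : 'I_n -> 'rV[R]_p -> R).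
Hypothesis f_diff : forall i x, differentiable (f i) x.

Let averageE : average f = (n%:R^-1 : R) *: \sum_i f i.
Proof.
apply/funext => x; rewrite /average [RHS]/GRing.scale/=; congr (_ * _).
by rewrite fct_sumE.
Qed.

Lemma differentiable_average x : differentiable (average f) x.
Proof.
rewrite averageE; apply: differentiableZ; apply: differentiable_sum => i.
exact: f_diff.
Qed.

Lemma grad_average x : grad (average f) x = n%:R^-1 *: \sum_i grad (f i) x.
Proof.
apply/matrixP => i j; rewrite !mxE summxE averageE deriveZ; last first.
  by apply: derivable_sum => k; exact: diff_derivable.
rewrite derive_sum => [|k]; last exact: diff_derivable.
by congr (_ *: _); apply: eq_bigr => k _; rewrite mxE.
Qed.

Lemma row_stacked_grad (X : 'M[R]_(n, p)) i :
  row i (stacked_grad f X) = grad (f i) (row i X).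
Proof. by apply/matrixP => k j; rewrite ord1 !mxE. Qed.

Variable L : R.
Hypothesis L_ge0 : 0 <= L.
Hypothesis f_lip : forall i, lipschitz_grad L (f i).

Lemma stacked_grad_lip (X Y : 'M[R]_(n, p)) :
  frob (stacked_grad f X - stacked_grad f Y) <= L * frob (X - Y).
Proof.
rewrite -(@ler_pXn2r _ 2)// ?nnegrE ?mulr_ge0 ?frob_ge0// exprMn.
rewrite !sqr_frob_row mulr_sumr ler_sum// => i _; rewrite -exprMn.
rewrite ler_pXn2r ?nnegrE ?mulr_ge0 ?frob_ge0//.
by rewrite !linearB/= !row_stacked_grad; exact: f_lip.
Qed.

Hypothesis n_gt0 : (0 < n)%N.

Lemma grad_average_lip : lipschitz_grad L (average f).
Proof.
move=> x y; rewrite !grad_average -scalerBr -sumrB frobZ ger0_norm ?invr_ge0//.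
have nR : 0 < n%:R :> R by rewrite ltr0n.
rewrite mulrC ler_pdivrMr//.
have : forall s : seq 'I_n, frob (\sum_(i <- s) (grad (f i) x - grad (f i) y)) <=
    \sum_(i <- s) L * frob (x - y).
  elim=> [|i s IH].
    by rewrite !big_nil -(scale0r (0 : 'rV[R]_p)) frobZ normr0 mul0r.
  by rewrite !big_cons; apply: (le_trans (frobD _ _)); apply: lerD => //; exact: f_lip.
move=> /(_ (index_enum _))/le_trans; apply.
by rewrite sumr_const card_ord -[_ *+ n]mulr_natr.
Qed.

(** The tracked mean gradient is the mean of the local ones, each at its own row;
    replacing every row by the mean costs at most [L] times the deviation, and
    averaging the [n] errors gains the factor [1 / n]. *)
Lemma mean_grad_error (X : 'M[R]_(n, p)) :
  n%:R * frob (row_mean (stacked_grad f X) - grad (average f) (row_mean X)) ^+ 2 <=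
  L ^+ 2 * frob (deviation X) ^+ 2.
Proof.
pose Xb : 'M[R]_(n, p) := const_mx 1 *m row_mean X.
have rowXb i : row i Xb = row_mean X.
  apply/matrixP => k j; rewrite !mxE big_ord1 !mxE mul1r; congr (_ * _).
  by apply: eq_bigr => l _; rewrite !mxE.
have -> : grad (average f) (row_mean X) = row_mean (stacked_grad f Xb).
  rewrite grad_average [RHS]row_meanE; congr (_ *: _).
  by apply: eq_bigr => i _; rewrite row_stacked_grad rowXb.
rewrite -row_meanB.
apply: (@le_trans _ _ (frob (stacked_grad f X - stacked_grad f Xb) ^+ 2)).
  by rewrite [leRHS](sqr_frob_deviation n_gt0) lerDr sqr_ge0.
rewrite -exprMn ler_pXn2r ?nnegrE ?mulr_ge0 ?frob_ge0//.
exact: stacked_grad_lip.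
Qed.

End Gradient.

Section StronglyConvex.
Context {R : realType} {p : nat} (g : 'rV[R]_p -> R) (mu L : R).
Hypothesis g_convex : strongly_convex mu g.
Hypothesis g_lip : lipschitz_grad L g.

(** Strong monotonicity and Lipschitz continuity of the gradient bound the same inner
    product from both sides, at two points that exist in positive dimension. *)
Lemma strongly_convex_le_lip : (0 < p)%N -> mu <= L.
Proof.
case: p g g_convex g_lip => // q h hc hl _.
have := hc (delta_mx 0 0) 0; rewrite subr0 => H.
have e0 : 0 < frob (delta_mx 0 0 : 'rV[R]_q.+1).
  rewrite lt_neqAle frob_ge0 andbT eq_sym; apply/eqP => /frob_eq0/matrixP/(_ 0 0).
  by rewrite !mxE !eqxx => /eqP; rewrite oner_eq0.
have Hd : inner (grad h (delta_mx 0 0) - grad h 0) (delta_mx 0 0) <=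
    frob (grad h (delta_mx 0 0) - grad h 0) * frob (delta_mx 0 0 : 'rV[R]_q.+1).
  by rewrite (le_trans _ (dotmx_le _ _))// /dotmx big_ord1.
have := hl (delta_mx 0 0) 0; rewrite subr0 => Hl.
rewrite -(ler_pM2r (exprn_gt0 2 e0)).
apply: (le_trans H); apply: (le_trans Hd).
by rewrite expr2 mulrA ler_pM2r.
Qed.

(** Expand the square: the gradient vanishes at [y], so strong monotonicity bounds the
    cross term and the Lipschitz bound the last one.  The quadratic term in [eta] is
    absorbed later by the smallness of [eta]. *)
Lemma gradient_step eta x y : 0 <= eta -> 0 <= L -> grad g y = 0 ->
  frob (x - eta *: grad g x - y) ^+ 2 <=
  (1 - 2 * eta * mu + eta ^+ 2 * L ^+ 2) * frob (x - y) ^+ 2.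
Proof.
move=> eta0 L0 gy.
have -> : x - eta *: grad g x - y = (x - y) + (- eta) *: grad g x.
  by rewrite addrAC scaleNr.
rewrite sqr_frobD frobZ exprMn real_normK ?num_real// sqrrN dotmxZr.
have : mu * frob (x - y) ^+ 2 <= dotmx (x - y) (grad g x).
  rewrite dotmxC (le_trans (g_convex x y))// gy subr0.
  by rewrite /dotmx big_ord1.
have : frob (grad g x) ^+ 2 <= L ^+ 2 * frob (x - y) ^+ 2.
  rewrite -exprMn ler_pXn2r ?nnegrE ?mulr_ge0 ?frob_ge0//.
  by have := g_lip x y; rewrite gy subr0.
move=> /(ler_wpM2l (sqr_ge0 eta)) A /(ler_wpM2l eta0) B; lra.
Qed.

End StronglyConvex.

(** * One iteration, outcome by outcome *)

Section Young.
Context {R : realType} {m n : nat}.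
Implicit Types A B D : 'M[R]_(m, n).

Lemma young (w x y : R) : 0 < w -> 2 * (x * y) <= w * x ^+ 2 + w^-1 * y ^+ 2.
Proof.
move=> w0; rewrite -subr_ge0.
have -> : w * x ^+ 2 + w^-1 * y ^+ 2 - 2 * (x * y) = w^-1 * (w * x - y) ^+ 2.
  by field; exact: lt0r_neq0.
by rewrite mulr_ge0 ?invr_ge0 ?(ltW w0)// sqr_ge0.
Qed.

Lemma sqr_frobD_le w A B : 0 < w ->
  frob (A + B) ^+ 2 <= (1 + w) * frob A ^+ 2 + (1 + w^-1) * frob B ^+ 2.
Proof.
move=> w0; rewrite sqr_frobD.
have := young (frob A) (frob B) w0; have := dotmx_le A B; lra.
Qed.

Lemma sqr_frobD2 A B : frob (A + B) ^+ 2 <= 2 * (frob A ^+ 2 + frob B ^+ 2).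
Proof. have := sqr_frobD_le A B ltr01; rewrite invr1; lra. Qed.

Lemma sqr_frobD3 A B D :
  frob (A + B + D) ^+ 2 <= 3 * (frob A ^+ 2 + frob B ^+ 2 + frob D ^+ 2).
Proof.
have w0 : 0 < 1 / 2 :> R by lra.
have := sqr_frobD_le (A + B) D w0; have := sqr_frobD2 A B.
have -> : (1 / 2 : R)^-1 = 2 by field.
lra.
Qed.

Lemma sqr_frob_convex t A B : 0 <= t <= 1 ->
  frob ((1 - t) *: A + t *: B) ^+ 2 <= (1 - t) * frob A ^+ 2 + t * frob B ^+ 2.
Proof.
move=> /andP[t0 t1]; rewrite sqr_frobD !frobZ !exprMn !real_normK ?num_real//.
rewrite dotmxZl dotmxZr.
have := young (frob A) (frob B) ltr01; rewrite invr1; have := dotmx_le A B => H1 H2.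
have tt : 0 <= t * (1 - t) by rewrite mulr_ge0// subr_ge0.
have : 0 <= t * (1 - t) * (frob A ^+ 2 + frob B ^+ 2 - 2 * dotmx A B).
  by rewrite mulr_ge0//; lra.
lra.
Qed.

(** Weighted Young inequality with the weight that turns [rho ^ 2] into
    [(1 + rho ^ 2) / 2]; stated without dividing by [rho], which may vanish. *)
Lemma contraction_sqr (rho a b c : R) : 0 <= rho < 1 -> 0 <= a -> 0 <= b ->
  0 <= c -> c <= rho * a + b ->
  c ^+ 2 <= (1 + rho ^+ 2) / 2 * a ^+ 2 + (1 - rho)^-1 * b ^+ 2.
Proof.
move=> /andP[r0 r1] a0 b0 c0 cab.
apply: (@le_trans _ _ ((rho * a + b) ^+ 2)).
  by rewrite ler_pXn2r// nnegrE addr_ge0// mulr_ge0.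
have s0 : 0 < 1 - rho by lra.
have := young a b s0 => /(ler_wpM2l r0).
have E : (1 - rho)^-1 = 1 + rho * (1 - rho)^-1 by field; apply: lt0r_neq0.
rewrite {2}E.
have : 0 <= (1 - rho) ^+ 2 * a ^+ 2 by rewrite mulr_ge0 ?sqr_ge0.
nra.
Qed.

End Young.

Section CompressedGradientTracking.
Context {R : realType} {n p : nat}.
Hypothesis n_gt0 : (0 < n)%N.
Variables (f : 'I_n -> 'rV[R]_p -> R) (mu L : R) (xstar : 'rV[R]_p).
Hypothesis f_diff : forall i x, differentiable (f i) x.
Hypotheses (mu_gt0 : 0 < mu) (L_ge0 : 0 <= L).
Hypothesis f_convex : strongly_convex mu (average f).
Hypothesis f_lip : forall i, lipschitz_grad L (f i).
Hypothesis grad_xstar : grad (average f) xstar = 0.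
Variable W : 'M[R]_n.
Hypothesis W_stoch : doubly_stochastic W.

Let s : R := 1 - spectral_norm (W - n%:R^-1 *: const_mx 1).
Let N : R := spectral_norm (1%:M - W).
Hypothesis s_gt0 : 0 < s.

Variables (gamma eta : R).
Hypotheses (gamma_gt0 : 0 < gamma) (gamma_le1 : gamma <= 1) (eta_gt0 : 0 < eta).

Let N_ge0 : 0 <= N. Proof. exact: spectral_norm_ge0. Qed.
Let nR : 0 < n%:R :> R. Proof. by rewrite ltr0n. Qed.

Variables (X Xhat Y Yhat : 'M[R]_(n, p)).
Hypothesis track : row_mean Y = row_mean (stacked_grad f X).

Let X' := X - gamma *: ((1%:M - W) *m Xhat) - eta *: Y.
Let Y' := Y - gamma *: ((1%:M - W) *m Yhat)
  + stacked_grad f X' - stacked_grad f X.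

Let o := frob (row_mean X - xstar) ^+ 2.
Let c := frob (deviation X) ^+ 2.
Let g := frob (deviation Y) ^+ 2.
Let ex := frob (Xhat - X) ^+ 2.
Let ey := frob (Yhat - Y) ^+ 2.

Lemma mean_step : row_mean X' = row_mean X - eta *: row_mean Y.
Proof. by rewrite !row_meanB !row_meanZ row_mean_laplacian// scaler0 subr0. Qed.

(** The columns of [1 - W] sum to zero, so gossip keeps the mean of [Y], and the
    gradient corrections telescope. *)
Lemma tracking_step : row_mean Y' = row_mean (stacked_grad f X').
Proof.
rewrite /Y' row_meanB row_meanD row_meanB row_meanZ row_mean_laplacian//.
by rewrite scaler0 subr0 track addrAC subrr add0r.
Qed.

(** The mean iterate makes an exact gradient step on the average objective, up to the
    error of the tracked mean gradient.  The exact step contracts by [1 - 23/12 eta mu];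
    Young's weight [5/12 eta mu] gives back a part and leaves [1 - 3/2 eta mu]. *)
Lemma optimality_step : eta ^+ 2 * L ^+ 2 <= eta * mu / 12 -> eta * mu <= 1 / 12 ->
  frob (row_mean X' - xstar) ^+ 2 <=
  (1 - 3 / 2 * eta * mu) * o + 3 * eta * L ^+ 2 / (mu * n%:R) * c.
Proof.
move=> etaL etamu; rewrite mean_step track.
pose h := grad (average f) (row_mean X); set Yb := row_mean (stacked_grad f X).
have -> : row_mean X - eta *: Yb - xstar =
    (row_mean X - eta *: h - xstar) + (- eta) *: (Yb - h).
  move: (row_mean X) Yb h => x y z.
  by apply/matrixP => i j; rewrite !mxE; ring.
set a := row_mean X - eta *: h - xstar; set b := Yb - h.
have w0 : 0 < 5 / 12 * (eta * mu) by rewrite mulr_gt0 ?mulr_gt0//; lra.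
apply: (le_trans (sqr_frobD_le _ _ w0)).
rewrite frobZ normrN (gtr0_norm eta_gt0) exprMn.
have Ha : frob a ^+ 2 <= (1 - 23 / 12 * (eta * mu)) * o.
  have lip := grad_average_lip f_diff f_lip n_gt0.
  have := gradient_step f_convex lip (row_mean X) (ltW eta_gt0) L_ge0 grad_xstar.
  move=> /le_trans; apply.
  by apply: ler_wpM2r; [exact: sqr_ge0|lra].
have Hb : n%:R * frob b ^+ 2 <= L ^+ 2 * c.
  exact: (mean_grad_error f_diff L_ge0 f_lip n_gt0).
have o0 : 0 <= o by exact: sqr_ge0.
have c0 : 0 <= c by exact: sqr_ge0.
have b0 : 0 <= frob b ^+ 2 by exact: sqr_ge0.
apply: lerD.
  apply: (@le_trans _ _ ((1 + 5 / 12 * (eta * mu)) *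
    ((1 - 23 / 12 * (eta * mu)) * o))).
    by apply: ler_wpM2l => //; lra.
  rewrite mulrA; apply: ler_wpM2r => //.
  have := sqr_ge0 (eta * mu); lra.
have -> : (1 + (5 / 12 * (eta * mu))^-1) * (eta ^+ 2 * frob b ^+ 2) =
    (eta * (eta * mu) + 12 / 5 * eta) / (mu * n%:R) * (n%:R * frob b ^+ 2).
  by field; rewrite !lt0r_neq0.
have -> : 3 * eta * L ^+ 2 / (mu * n%:R) * c = 3 * eta / (mu * n%:R) * (L ^+ 2 * c).
  by field; rewrite !lt0r_neq0.
apply: ler_pM => //.
- by rewrite divr_ge0 ?mulr_ge0 ?addr_ge0 ?mulr_ge0// ltW.
- by rewrite mulr_ge0// ltW.
rewrite ler_pM2r ?invr_gt0 ?mulr_gt0//.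
have := ler_wpM2l (ltW eta_gt0) etamu; have := eta_gt0.
by move: (eta * (eta * mu)) => z; lra.
Qed.

Lemma laplacian_error (Z Zhat : 'M[R]_(n, p)) :
  frob (gamma *: ((1%:M - W) *m (Zhat - Z))) ^+ 2 <=
  gamma ^+ 2 * N ^+ 2 * frob (Zhat - Z) ^+ 2.
Proof.
rewrite frobZ (gtr0_norm gamma_gt0) -!exprMn.
rewrite ler_pXn2r ?nnegrE ?mulr_ge0 ?frob_ge0 ?(ltW gamma_gt0)//.
by rewrite -mulrA ler_pM2l// frob_spectral.
Qed.

(** Writing [Zhat = Z + (Zhat - Z)], the round contracts the deviation of [Z], and the
    compression error and [V] act as one perturbation; its weight [1 / (gamma s)] is the
    price of Young's inequality for the contraction factor [1 - gamma s]. *)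
Lemma perturbed_gossip (Z Zhat V : 'M[R]_(n, p)) :
  frob (deviation (Z - gamma *: ((1%:M - W) *m Zhat) + V)) ^+ 2 <=
  (1 + (1 - gamma * s) ^+ 2) / 2 * frob (deviation Z) ^+ 2
  + 2 / (gamma * s) *
    (gamma ^+ 2 * N ^+ 2 * frob (Zhat - Z) ^+ 2 + frob V ^+ 2).
Proof.
pose E := gamma *: ((1%:M - W) *m (Zhat - Z)).
have -> : deviation (Z - gamma *: ((1%:M - W) *m Zhat) + V) =
    (deviation Z - gamma *: ((1%:M - W) *m deviation Z)) + (deviation V - E).
  rewrite deviationD deviationB deviationZ deviation_laplacian// laplacian_deviation//.
  rewrite /E mulmxBr; move: (deviation Z) (deviation V) (_ *m Z) (_ *m Zhat).
  by move=> A B D F; apply/matrixP => i j; rewrite !mxE; ring.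
have gs : 0 < gamma * s by rewrite mulr_gt0.
have s1 : s <= 1 by rewrite gerBl spectral_norm_ge0.
have gs1 : gamma * s <= 1.
  by rewrite -[leRHS]mulr1; apply: ler_pM => //; exact: ltW.
have -> : 2 / (gamma * s) * (gamma ^+ 2 * N ^+ 2 * frob (Zhat - Z) ^+ 2 + frob V ^+ 2)
  = (gamma * s)^-1 *
    (2 * (frob V ^+ 2 + gamma ^+ 2 * N ^+ 2 * frob (Zhat - Z) ^+ 2)) by ring.
have {2}-> : gamma * s = 1 - (1 - gamma * s) by ring.
set A := _ - _; set B := deviation V - E.
apply: (@le_trans _ _ ((1 + (1 - gamma * s) ^+ 2) / 2 * frob (deviation Z) ^+ 2 +
   (1 - (1 - gamma * s))^-1 * frob B ^+ 2)).
  apply: contraction_sqr; rewrite ?frob_ge0//; first by apply/andP; split; lra.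
  apply: (le_trans (frobD _ _)); apply: lerD => //.
  by apply: gossip_contraction => //; rewrite (ltW gamma_gt0).
rewrite lerD2l ler_pM2l; last by rewrite invr_gt0; lra.
apply: (le_trans (sqr_frobD2 _ _)); rewrite frobN ler_pM2l// lerD//.
  by rewrite ler_pXn2r ?nnegrE ?frob_ge0// frob_deviation_le.
exact: laplacian_error.
Qed.

Lemma consensus_step :
  frob (deviation X') ^+ 2 <=
  (1 + (1 - gamma * s) ^+ 2) / 2 * c + 2 / s * (eta ^+ 2 / gamma) * g
  + 2 / s * N ^+ 2 * gamma * ex.
Proof.
have -> : deviation X' = deviation (X - gamma *: ((1%:M - W) *m Xhat)
    + - (eta *: deviation Y)).
  rewrite [RHS]deviationD -[- (eta *: deviation Y)]scaleNr [in RHS]deviationZ.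
  rewrite deviationK// -deviationZ -deviationD.
  by rewrite scaleNr.
apply: (le_trans (perturbed_gossip _ _ _)).
rewrite frobN frobZ (gtr0_norm eta_gt0) exprMn -/c -/g -/ex.
by rewrite le_eqVlt; apply/orP; left; apply/eqP; field; rewrite !lt0r_neq0.
Qed.

(** The gossip term splits into the part due to the deviation and the part due to the
    compression error; [Y] splits into its deviation and its mean, and the mean is
    compared with the gradient of the average objective at the mean iterate. *)
Lemma displacement :
  frob (X' - X) ^+ 2 <=
  6 * n%:R * L ^+ 2 * eta ^+ 2 * o
  + (6 * L ^+ 2 * eta ^+ 2 + 3 * gamma ^+ 2 * N ^+ 2) * c
  + 3 * eta ^+ 2 * g + 3 * gamma ^+ 2 * N ^+ 2 * ex.
Proof.
have -> : X' - X = - (gamma *: ((1%:M - W) *m (deviation X - 0)))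
    + - (gamma *: ((1%:M - W) *m (Xhat - X))) + (- eta) *: Y.
  rewrite subr0 laplacian_deviation// mulmxBr /X'; move: (_ *m X) (_ *m Xhat).
  by move=> A B; apply/matrixP => i j; rewrite !mxE; ring.
apply: (le_trans (sqr_frobD3 _ _ _)).
rewrite !frobN [frob (- eta *: Y)]frobZ normrN (gtr0_norm eta_gt0) exprMn.
have H1 := laplacian_error 0 (deviation X); rewrite !subr0 -/c in H1.
have H2 := laplacian_error X Xhat; rewrite -/ex in H2.
have H3 : frob Y ^+ 2 <= g + 2 * L ^+ 2 * c + 2 * n%:R * L ^+ 2 * o.
  rewrite (sqr_frob_deviation n_gt0) -/g -addrA lerD2l.
  have Hb := mean_grad_error f_diff L_ge0 f_lip n_gt0 X.
  rewrite -track -/c in Hb.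
  set h := grad (average f) (row_mean X) in Hb.
  have Hh : frob h ^+ 2 <= L ^+ 2 * o.
    rewrite -exprMn ler_pXn2r ?nnegrE ?mulr_ge0 ?frob_ge0//.
    have := grad_average_lip f_diff f_lip n_gt0 (row_mean X) xstar.
    by rewrite grad_xstar subr0.
  have := sqr_frobD2 (row_mean Y - h) h; rewrite subrK.
  move=> /(ler_wpM2l (ltW nR)) Hs; have := ler_wpM2l (ltW nR) Hh; lra.
have := ler_wpM2l (sqr_ge0 eta) H3; rewrite subr0; lra.
Qed.

(** The perturbation of the gossip round is the change of the local gradients, hence at
    most [L] times the displacement of the iterate. *)
Lemma tracking_error_step :
  frob (deviation Y') ^+ 2 <=
  (1 + (1 - gamma * s) ^+ 2) / 2 * g + 2 / s * N ^+ 2 * gamma * ey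
  + 2 / (gamma * s) * L ^+ 2 * frob (X' - X) ^+ 2.
Proof.
have -> : Y' = Y - gamma *: ((1%:M - W) *m Yhat)
    + (stacked_grad f X' - stacked_grad f X) by rewrite addrA.
apply: (le_trans (perturbed_gossip _ _ _)); rewrite -/g -/ey -addrA lerD2l.
have H : frob (stacked_grad f X' - stacked_grad f X) ^+ 2 <=
    L ^+ 2 * frob (X' - X) ^+ 2.
  rewrite -exprMn ler_pXn2r ?nnegrE ?mulr_ge0 ?frob_ge0//.
  exact: stacked_grad_lip.
have k0 : 0 <= 2 / (gamma * s) by rewrite divr_ge0 ?mulr_ge0 ?ltW.
have := ler_wpM2l k0 H; rewrite [_ * (_ + frob _ ^+ 2)]mulrDr.
have -> : 2 / (gamma * s) * (gamma ^+ 2 * N ^+ 2 * ey) = 2 / s * N ^+ 2 * gamma * ey.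
  by field; rewrite !lt0r_neq0.
lra.
Qed.

Lemma tracking_displacement :
  frob (Y' - Y) ^+ 2 <=
  3 * gamma ^+ 2 * N ^+ 2 * g + 3 * gamma ^+ 2 * N ^+ 2 * ey
  + 3 * L ^+ 2 * frob (X' - X) ^+ 2.
Proof.
have -> : Y' - Y = - (gamma *: ((1%:M - W) *m (deviation Y - 0)))
    + - (gamma *: ((1%:M - W) *m (Yhat - Y)))
    + (stacked_grad f X' - stacked_grad f X).
  rewrite subr0 laplacian_deviation// mulmxBr /Y'.
  move: (stacked_grad f X') (stacked_grad f X) (_ *m Y) (_ *m Yhat).
  by move=> F F' A B; apply/matrixP => i j; rewrite !mxE; ring.
apply: (le_trans (sqr_frobD3 _ _ _)); rewrite !frobN.
have H1 := laplacian_error 0 (deviation Y); rewrite !subr0 -/g in H1.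
have H2 := laplacian_error Y Yhat; rewrite -/ey in H2.
have H : frob (stacked_grad f X' - stacked_grad f X) ^+ 2 <=
    L ^+ 2 * frob (X' - X) ^+ 2.
  rewrite -exprMn ler_pXn2r ?nnegrE ?mulr_ge0 ?frob_ge0//.
  exact: stacked_grad_lip.
rewrite subr0; lra.
Qed.

(** The compression state moves towards its target by a fraction [alpha r] of the
    rescaled compressed difference, whence the convex combination. *)
Lemma compression_step (tau alpha r : R) (Z Z' H Q : 'M[R]_(n, p)) : 1 < tau ->
  0 < r -> 0 <= alpha * r <= 1 ->
  frob (Z' - ((1 - alpha) *: H + alpha *: (H + Q))) ^+ 2 <=
  tau * ((1 - alpha * r) * frob (Z - H) ^+ 2
         + alpha * r * frob (r^-1 *: Q - (Z - H)) ^+ 2)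
  + tau / (tau - 1) * frob (Z' - Z) ^+ 2.
Proof.
move=> tau1 r0 ar.
have w0 : 0 < tau - 1 by rewrite subr_gt0.
pose B := (1 - alpha * r) *: (Z - H) + (alpha * r) *: - (r^-1 *: Q - (Z - H)).
have -> : Z' - ((1 - alpha) *: H + alpha *: (H + Q)) = B + (Z' - Z).
  by apply/matrixP => i j; rewrite !mxE; field; exact: lt0r_neq0.
apply: (le_trans (sqr_frobD_le _ _ w0)).
have -> : 1 + (tau - 1) = tau by ring.
have -> : 1 + (tau - 1)^-1 = tau / (tau - 1) by field; rewrite lt0r_neq0.
rewrite lerD2r ler_pM2l ?(lt_trans _ tau1)//.
by apply: (le_trans (sqr_frob_convex _ _ ar)); rewrite frobN.
Qed.

End CompressedGradientTracking.

(** * Borel vectors and independent seeds *)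

Section BorelVectors.
Context {R : realType} {p : nat}.

Lemma mx_ballE (c x : 'rV[R]_p) (e : R) : 0 < e ->
  ball c e x <-> forall j, ball (c 0 j) e (x 0 j).
Proof.
move=> e0; split=> [[_ H] j|H]; first exact: H.
by split => // i j; rewrite ord1; exact: H.
Qed.

(** Every open set is the union of the countably many rational balls inside it,
    and a ball of the maximum norm is a finite intersection of coordinate
    conditions. *)
Lemma measurable_borel_rV d (T : measurableType d) (g : T -> 'rV[R]_p) :
  (forall j, measurable_fun [set: T] (fun w => g w 0 j)) ->
  measurable_fun [set: T] (g : T -> borel_rV R p).
Proof.
move=> mg; apply: (@measurability _ _ T (borel_rV R p) setT g (@open 'rV[R]_p) erefl).
move=> _ [U oU <-]; rewrite setTI.
pose c (q : 'rV[rat]_p * rat) : 'rV[R]_p := map_mx ratr q.1.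
pose good (q : 'rV[rat]_p * rat) := 0 < q.2 /\ ball (c q) (ratr q.2) `<=` U.
pose F (q : 'rV[rat]_p * rat) : set T :=
  [set w | good q /\ ball (c q) (ratr q.2 : R) (g w)].
have -> : g @^-1` U = \bigcup_q F q.
  apply/seteqP; split => [w /= Uw|w [q _ [[_ sub]]]]; last exact: sub.
  have /nbhs_ballP[e /= e0 eU] : nbhs (g w) U by apply: open_nbhs_nbhs.
  have [|r] := @rat_in_itvoo R 0 (e / 2); first by rewrite divr_gt0.
  rewrite in_itv/= => /andP[r0 re].
  have pick j : {q : rat | ball (ratr q : R) (ratr r) (g w 0 j)}.
    apply: cid; have [|q] := @rat_in_itvoo R (g w 0 j - ratr r) (g w 0 j + ratr r).
      by rewrite ltrBlDr -addrA ltrDl addr_gt0.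
    rewrite in_itv/= => /andP[q1 q2]; exists q.
    by rewrite /ball/= ltr_norml; apply/andP; split; lra.
  pose q : 'rV[rat]_p := \row_j sval (pick j).
  have gq : ball (c (q, r)) (ratr r : R) (g w).
    by apply/mx_ballE => // j; rewrite !mxE; exact: (svalP (pick j)).
  exists (q, r) => //; split => //; split; first by rewrite -(@ltr0q R).
  move=> y /= yq; apply: eU; apply: (@le_ball _ _ _ (ratr r + ratr r)); first lra.
  by apply: ball_triangle yq; exact: ball_sym.
apply: countable_bigcupT_measurable => // q.
have [gq|ngq] := pselect (good q); last first.
  rewrite (_ : F q = set0); first exact: measurable0.
  by apply/seteqP; split => // w [].
have q0 : 0 < ratr q.2 :> R by rewrite ltr0q; case: gq.
have -> : F q = \bigcap_(j in [set: 'I_p])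
    ((fun w => g w 0 j) @^-1` ball (c q 0 j) (ratr q.2 : R)).
  apply/seteqP; split => [w [_ /mx_ballE] H j _|w H]; first exact: H.
  by split => //; apply/mx_ballE => // j; exact: H.
apply: fin_bigcap_measurable => [|j _]; first exact: finite_finset.
rewrite -[X in measurable X]setTI; apply: (mg j) => //.
by apply: open_measurable; exact: ball_open.
Qed.

Lemma continuous_borel_rV (h : 'rV[R]_p -> R) : continuous h ->
  measurable_fun [set: borel_rV R p] (h : borel_rV R p -> R).
Proof.
move=> ch; apply: (measurability _ (RGenOpens.measurableE R)).
move=> _ [_ [a [b ->] <-]]; rewrite setTI; apply: sub_sigma_algebra.
by move/continuousP: ch; apply; exact: interval_open.
Qed.

Lemma measurable_borel_coord j :
  measurable_fun [set: borel_rV R p] (fun x : borel_rV R p => (x : 'rV[R]_p) 0 j).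
Proof. by apply: continuous_borel_rV; exact: coord_continuous. Qed.

End BorelVectors.

Section Independence.
Context {R : realType} {d d' : measure_display} {Omega : measurableType d}
  {P : probability Omega R} {Xi : measurableType d'} {nu : probability Xi R}
  {I : choiceType} (xi : I -> {RV P >-> Xi}).
Hypothesis xi_iid : iid nu xi.

(** A pi-system, since the family [A] is indexed by all of [I]. *)
Definition cylinders (J : seq I) : set (set Omega) :=
  [set \bigcap_(i in [set` J]) (xi i @^-1` A i) |
   A in [set A : I -> set Xi | forall i, measurable (A i)]].

(** The sigma-algebra generated by the seeds in [J], as a measurable type on the same
    outcomes: depending only on these seeds becomes measurability from this type, and
    products with it are available. *)
Definition sigma_seeds (J : seq I) := g_sigma_algebraType (cylinders J).

Variable J : seq I.
Hypothesis J_uniq : uniq J.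

Lemma cylinders_setI : setI_closed (cylinders J).
Proof.
move=> _ _ [A mA <-] [B mB <-]; exists (fun i => A i `&` B i).
  by move=> i; exact: measurableI.
apply/seteqP; split => [w H|w [HA HB] i Ji].
  by split => i Ji; have [] := H i Ji.
by split; [exact: HA|exact: HB].
Qed.

Lemma cylinders_setT : cylinders J setT.
Proof.
exists (fun=> setT) => //; apply/seteqP; split => // w _ i _; exact: I.
Qed.

Lemma cylinders_measurable B : cylinders J B -> measurable B.
Proof.
move=> [A mA <-]; apply: fin_bigcap_measurable => [|i _]; first exact: finite_seq.
by rewrite -[X in measurable X]setTI; exact: measurable_funP.
Qed.

Lemma measurable_sigma_seeds i : i \in J ->
  measurable_fun [set: sigma_seeds J] (xi i : sigma_seeds J -> Xi).
Proof.
move=> iJ _ A mA; rewrite setTI; apply: sub_sigma_algebra.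
exists (fun k => if k == i then A else setT).
  by move=> k; case: ifP => // _; exact: measurableT.
apply/seteqP; split => [w H|w H k _].
  by have := H i iJ; rewrite /preimage/= eqxx.
by rewrite /preimage/=; case: eqP => // ->.
Qed.

Lemma measurable_id_sigma_seeds :
  measurable_fun [set: Omega] (idfun : Omega -> sigma_seeds J).
Proof.
apply: (@measurability _ _ Omega (sigma_seeds J) setT idfun (cylinders J) erefl).
by move=> _ [B cB <-]; rewrite setTI; exact: cylinders_measurable.
Qed.

Variable e : I.
Hypothesis eJ : e \notin J.

Let idJ : {mfun Omega >-> sigma_seeds J} :=
  mfun_Sub (mem_set measurable_id_sigma_seeds).

Let pair_mfun : measurable_fun [set: Omega]
  (fun w => (xi e w, w) : Xi * sigma_seeds J).
Proof.
apply: measurable_fun_pair; first exact: measurable_funP.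
exact: measurable_id_sigma_seeds.
Qed.

Let pairJ : {mfun Omega >-> (Xi * sigma_seeds J)%type} :=
  mfun_Sub (mem_set pair_mfun).

Let probJ := distribution P idJ.

(* Both sides are finite measures in [B] that agree on the pi-system of cylinders. *)
Let seed_indep (A : set Xi) (B : set Omega) : measurable A ->
  measurable (B : set (sigma_seeds J)) ->
  P (xi e @^-1` A `&` B) = (nu A * P B)%E.
Proof.
move=> mA mB.
have mxA : measurable (xi e @^-1` A).
  by rewrite -[X in measurable X]setTI; exact: measurable_funP.
have nuA : (0 <= fine (nu A))%R by exact: fine_ge0.
pose m1 := mrestr P mxA.
pose m2 := mscale (NngNum nuA) P.
suff : m1 B = m2 B.
  rewrite /m1 /m2 /= /mrestr /mscale/= fineK ?fin_num_measure// => <-.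
  by rewrite setIC.
apply: (g_sigma_algebra_measure_unique (cylinders J) _ (fun=> setT)) => //.
- by move=> C; exact: cylinders_measurable.
- by move=> _; exact: cylinders_setT.
- by apply/seteqP; split => // w _; exists 0%N.
- exact: cylinders_setI.
- move=> _ [C mC <-].
  rewrite /m1 /m2 /= /mrestr /mscale/= fineK ?fin_num_measure//.
  have [indep law] := xi_iid.
  pose D i := if i == e then A else C i.
  have mD i : measurable (D i) by rewrite /D; case: ifP.
  have DJ i : i \in J -> D i = C i.
    by rewrite /D; case: eqP => // ->; rewrite (negbTE eJ).
  have -> : \bigcap_(i in [set` J]) xi i @^-1` C i `&` xi e @^-1` A =
      \bigcap_(i in [set` e :: J]) xi i @^-1` D i.
    apply/seteqP; split => [w [H HA] i /=|w H].
      rewrite inE => /predU1P[->|iJ]; first by rewrite /D eqxx.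
      by rewrite DJ//; exact: H.
    split => [i /= iJ|].
      by rewrite /preimage/= -DJ//; apply: H; rewrite /= inE iJ orbT.
    by have := H e (mem_head e J); rewrite /D eqxx.
  rewrite (indep (e :: J) D)//= ?eJ// big_cons {1}/D eqxx; congr (_ * _)%E.
    exact: law.
  rewrite (indep J C)// big_seq [RHS]big_seq.
  by apply: eq_bigr => i iJ; rewrite DJ.
- move=> _; rewrite /m1/= /mrestr/=.
  by rewrite (le_lt_trans (probability_le1 _ _)) ?ltry// setTI.
Qed.

(** The joint law of the fresh seed and of the outcome seen through the seeds in [J] is
    the product of the marginals, because it is so on rectangles; Tonelli's theorem
    then integrates the fresh seed first. *)
Lemma integral_fresh_seed (h : Xi * sigma_seeds J -> \bar R) :
  measurable_fun setT h -> (forall z, 0 <= h z)%E ->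
  (\int[P]_w h (xi e w, w) = \int[P]_w \int[nu]_z h (z, w))%E.
Proof.
move=> mh h0.
rewrite -(@ge0_integral_distribution _ _ _ _ _ P pairJ h)//.
transitivity (\int[nu \x probJ]_z h z)%E.
  apply: eq_measure_integral => B mB _; apply/esym.
  by apply: product_measure_unique mB => A C; exact: seed_indep.
rewrite (@fubini_tonelli2 _ _ _ _ R nu (distribution P idJ) h)//.
rewrite (@ge0_integral_distribution _ _ _ _ _ P idJ)//.
- exact: measurable_fun_fubini_tonelli_G.
- by move=> y; exact: integral_ge0.
Qed.

End Independence.

(** * Second moments of the iterates *)

Section MeasurableMatrices.
Context {R : realType} {d : measure_display} {T : measurableType d}.

Definition measurable_mx m n (A : T -> 'M[R]_(m, n)) :=
  forall i j, measurable_fun [set: T] (fun w => A w i j).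

Lemma measurable_mx_cst m n (A : 'M[R]_(m, n)) : measurable_mx (fun=> A).
Proof. by move=> i j; exact: measurable_cst. Qed.

Lemma measurable_mxD m n (A B : T -> 'M[R]_(m, n)) :
  measurable_mx A -> measurable_mx B -> measurable_mx (fun w => A w + B w).
Proof.
move=> mA mB i j; under eq_fun do rewrite mxE.
exact: (measurable_funD (mA i j) (mB i j)).
Qed.

Lemma measurable_mxM l m n (D : 'M[R]_(l, m)) (A : T -> 'M[R]_(m, n)) :
  measurable_mx A -> measurable_mx (fun w => D *m A w).
Proof.
move=> mA i j; under eq_fun do rewrite mxE.
by apply: measurable_sum => k; apply: measurable_funM; [exact: measurable_cst|exact: mA].
Qed.

Lemma measurable_mxZ m n a (A : T -> 'M[R]_(m, n)) :
  measurable_mx A -> measurable_mx (fun w => a *: A w).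
Proof.
by move=> mA; under eq_fun do rewrite -mul_scalar_mx; exact: measurable_mxM.
Qed.

Lemma measurable_mxB m n (A B : T -> 'M[R]_(m, n)) :
  measurable_mx A -> measurable_mx B -> measurable_mx (fun w => A w - B w).
Proof.
move=> mA mB; under eq_fun do rewrite -scaleN1r.
by apply: measurable_mxD => //; exact: measurable_mxZ.
Qed.

Lemma measurable_mx_row m n i (A : T -> 'M[R]_(m, n)) :
  measurable_mx A -> measurable_mx (fun w => row i (A w)).
Proof. by move=> mA k j; under eq_fun do rewrite mxE; exact: mA. Qed.

Lemma measurable_row_mean m n (A : T -> 'M[R]_(m, n)) :
  measurable_mx A -> measurable_mx (fun w => row_mean (A w)).
Proof. by move=> mA; apply: measurable_mxZ; exact: measurable_mxM. Qed.

Lemma measurable_deviation m n (A : T -> 'M[R]_(m, n)) :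
  measurable_mx A -> measurable_mx (fun w => deviation (A w)).
Proof.
move=> mA; apply: measurable_mxB => //; apply: measurable_mxM.
exact: measurable_row_mean.
Qed.

Lemma measurable_sqr_frob m n (A : T -> 'M[R]_(m, n)) :
  measurable_mx A -> measurable_fun [set: T] (fun w => frob (A w) ^+ 2).
Proof.
move=> mA; under eq_fun do rewrite sqr_frob.
apply: measurable_sum => i; apply: measurable_sum => j.
exact: measurable_funX.
Qed.

Lemma measurable_borel_row p (g : T -> 'rV[R]_p) : measurable_mx g ->
  measurable_fun [set: T] (g : T -> borel_rV R p).
Proof. by move=> mg; apply: measurable_borel_rV => j; exact: mg. Qed.

Lemma measurable_stacked_grad n p (f : 'I_n -> 'rV[R]_p -> R) L :
  0 <= L -> (forall i, lipschitz_grad L (f i)) ->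
  forall X : T -> 'M[R]_(n, p), measurable_mx X ->
  measurable_mx (fun w => stacked_grad f (X w)).
Proof.
move=> L0 f_lip X mX i j; under eq_fun do rewrite mxE.
have mr := measurable_borel_row (measurable_mx_row i mX).
suff mg : measurable_fun [set: borel_rV R p]
    (fun x : borel_rV R p => grad (f i) (x : 'rV[R]_p) 0 j).
  exact: (measurableT_comp mg mr).
apply: (@continuous_borel_rV R p (fun x => grad (f i) x 0 j)) => x.
apply/(@cvgrPdist_lt _ _ _ (nbhs x)) => e e0; apply/nbhs_ballP.
have D0 : 0 < (L + 1) * (p%:R + 1) by rewrite mulr_gt0// ltr_wpDl.
exists (e / ((L + 1) * (p%:R + 1))) => /=; first by rewrite divr_gt0.
set eps := e / _; have eps0 : 0 < eps by rewrite divr_gt0.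
move=> y /(mx_ballE _ _ eps0) xy.
have -> : grad (f i) x 0 j - grad (f i) y 0 j = (grad (f i) x - grad (f i) y) 0 j.
  by rewrite !mxE.
apply: (le_lt_trans (le_frob_entry _ _ _)); apply: (le_lt_trans (f_lip i x y)).
(* [p + 1] is a crude bound for the ratio [sqrt p] of the Euclidean and the maximum
   norms that stays positive for [p = 0]. *)
have H : frob (x - y) <= (p%:R + 1) * eps.
  have r0 : 0 <= (p%:R + 1) * eps by apply: mulr_ge0; rewrite ?addr_ge0// ltW.
  rewrite -(@ler_pXn2r _ 2)// ?nnegrE ?frob_ge0//.
  rewrite sqr_frob big_ord1 exprMn.
  apply: (@le_trans _ _ (p%:R * eps ^+ 2)).
    have -> : p%:R * eps ^+ 2 = \sum_(k < p) eps ^+ 2.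
      by rewrite sumr_const card_ord mulr_natl.
    apply: ler_sum => k _; rewrite -real_normK ?num_real//.
    rewrite ler_pXn2r ?nnegrE ?(ltW eps0)// !mxE ltW//.
    exact: (xy k).
  apply: ler_wpM2r; first exact: sqr_ge0.
  by have := ler0n R p; nra.
apply: (le_lt_trans (ler_wpM2l L0 H)).
have -> : e = (L + 1) * ((p%:R + 1) * eps).
  by rewrite mulrA mulrC divfK// lt0r_neq0.
by rewrite ltr_pM2r ?ltrDl// mulr_gt0// ltr_wpDl.
Qed.

Lemma measurable_compress n p d' (Xi : measurableType d')
    (cop : Xi -> 'rV[R]_p -> 'rV[R]_p) (z : 'I_n -> T -> Xi)
    (Z : T -> 'M[R]_(n, p)) :
  measurable_fun [set: Xi * borel_rV R p]
    (fun z => cop z.1 z.2 : borel_rV R p) ->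
  (forall i, measurable_fun [set: T] (z i)) -> measurable_mx Z ->
  measurable_mx (fun w => compress cop (fun i => z i w) (Z w)).
Proof.
move=> mcop mz mZ i j; under eq_fun do rewrite mxE.
apply: (measurableT_comp (measurable_borel_coord j)).
apply: (@measurableT_comp _ _ _ _ _ _ (fun z : Xi * borel_rV R p =>
  cop z.1 z.2 : borel_rV R p) _ (fun w => (z i w, row i (Z w) : borel_rV R p))) => //.
apply: measurable_fun_pair => //.
exact: (measurable_borel_row (measurable_mx_row i mZ)).
Qed.

(** Stated over any measurable space carrying seeds, to be used both on the outcomes
    and on the sigma-algebra of the seeds drawn before iteration [k]. *)
Lemma measurable_cgt n p d' (Xi : measurableType d') (f : 'I_n -> 'rV[R]_p -> R) L
    (W : 'M[R]_n) (cop : Xi -> 'rV[R]_p -> 'rV[R]_p) (alphax alphay gamma eta : R)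
    (z : bool * nat * 'I_n -> T -> Xi) (X0 Hx0 Hy0 : 'M[R]_(n, p)) (k : nat) :
  0 <= L -> (forall i, lipschitz_grad L (f i)) ->
  measurable_fun [set: Xi * borel_rV R p]
    (fun z => cop z.1 z.2 : borel_rV R p) ->
  (forall b l i, (l < k)%N -> measurable_fun [set: T] (z (b, l, i))) ->
  let st := cgt f W cop alphax alphay gamma eta z X0 Hx0 Hy0 k in
  [/\ measurable_mx (fun w => st_X (st w)), measurable_mx (fun w => st_Hx (st w)),
      measurable_mx (fun w => st_Y (st w)) & measurable_mx (fun w => st_Hy (st w))].
Proof.
move=> L0 f_lip mcop; elim: k => [|k IH] mz.
  by split; exact: measurable_mx_cst.
have [b l i lk|mX mHx mY mHy] := IH; first by apply: mz; exact: ltnW.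
pose st w := cgt f W cop alphax alphay gamma eta z X0 Hx0 Hy0 k w.
pose Xh w := st_Hx (st w) + compress cop (fun i => z (true, k, i) w)
  (st_X (st w) - st_Hx (st w)).
pose Yh w := st_Hy (st w) + compress cop (fun i => z (false, k, i) w)
  (st_Y (st w) - st_Hy (st w)).
pose X' w := st_X (st w) - gamma *: ((1%:M - W) *m Xh w) - eta *: st_Y (st w).
have mXh : measurable_mx Xh.
  apply: measurable_mxD => //; apply: measurable_compress => //.
    by move=> i; exact: mz.
  exact: measurable_mxB.
have mYh : measurable_mx Yh.
  apply: measurable_mxD => //; apply: measurable_compress => //.
    by move=> i; exact: mz.
  exact: measurable_mxB.
have mX' : measurable_mx X'.
  apply: measurable_mxB; last exact: measurable_mxZ.
  by apply: measurable_mxB => //; apply: measurable_mxZ; exact: measurable_mxM.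
have mHx' : measurable_mx (fun w => (1 - alphax) *: st_Hx (st w) + alphax *: Xh w).
  by apply: measurable_mxD; exact: measurable_mxZ.
have mHy' : measurable_mx (fun w => (1 - alphay) *: st_Hy (st w) + alphay *: Yh w).
  by apply: measurable_mxD; exact: measurable_mxZ.
have mY' : measurable_mx (fun w => st_Y (st w) - gamma *: ((1%:M - W) *m Yh w)
    + stacked_grad f (X' w) - stacked_grad f (st_X (st w))).
  apply: measurable_mxB; last exact: measurable_stacked_grad f_lip _ _.
  apply: measurable_mxD; last exact: measurable_stacked_grad f_lip _ _.
  by apply: measurable_mxB => //; apply: measurable_mxZ; exact: measurable_mxM.
have E w : cgt f W cop alphax alphay gamma eta z X0 Hx0 Hy0 k.+1 w =
    CGTState (X' w) ((1 - alphax) *: st_Hx (st w) + alphax *: Xh w)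
      (st_Y (st w) - gamma *: ((1%:M - W) *m Yh w)
       + stacked_grad f (X' w) - stacked_grad f (st_X (st w)))
      ((1 - alphay) *: st_Hy (st w) + alphay *: Yh w).
  by rewrite /= /cgt_step /X' /Xh /Yh /st; case: cgt.
by split=> i j; under eq_fun do rewrite E;
  [exact: mX'|exact: mHx'|exact: mY'|exact: mHy'].
Qed.

End MeasurableMatrices.

Section Expectation.
Context {R : realType} {d : measure_display} {Omega : measurableType d}
  (P : probability Omega R).

(** Second moments are not known to be finite beforehand, so the recursion carries real
    upper bounds, together with what the integral needs to be monotone and additive. *)
Definition moment_le (phi : Omega -> R) (b : R) :=
  [/\ measurable_fun setT phi, forall w, 0 <= phi w & ('E_P[phi] <= b%:E)%E].

Lemma moment_leD phi psi b c : moment_le phi b -> moment_le psi c ->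
  moment_le (fun w => phi w + psi w) (b + c).
Proof.
move=> [mp p0 pb] [mq q0 qc]; split; first exact: measurable_funD.
  by move=> w; exact: addr_ge0.
move: pb qc; rewrite unlock => pb qc; rewrite EFinD.
under eq_integral do rewrite EFinD.
rewrite ge0_integralD//; first exact: leeD.
- by move=> w _; rewrite lee_fin.
- exact/measurable_EFinP.
- by move=> w _; rewrite lee_fin.
- exact/measurable_EFinP.
Qed.

Lemma moment_leZ a phi b : 0 <= a -> moment_le phi b ->
  moment_le (fun w => a * phi w) (a * b).
Proof.
move=> a0 [mp p0 pb]; split; first by apply: measurable_funM.
  by move=> w; exact: mulr_ge0.
move: pb; rewrite unlock => pb; rewrite EFinM.
under eq_integral do rewrite EFinM.
rewrite ge0_integralZl//; first by apply: lee_wpmul2l.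
- exact/measurable_EFinP.
- by move=> w _; rewrite lee_fin.
Qed.

Lemma moment_leW (phi psi : Omega -> R) b c :
  measurable_fun setT psi -> (forall w, 0 <= psi w) ->
  (forall w, psi w <= phi w) -> b <= c -> moment_le phi b -> moment_le psi c.
Proof.
move=> mpsi psi0 le bc [mp p0 pb]; split => //.
apply: (@le_trans _ _ b%:E); last by rewrite lee_fin.
apply: le_trans pb; rewrite unlock; apply: ge0_le_integral => //.
- by move=> w _; rewrite lee_fin.
- exact/measurable_EFinP.
- exact/measurable_EFinP.
- by move=> w _; rewrite lee_fin.
Qed.

Lemma moment_le_cst a b : 0 <= a -> a <= b -> moment_le (fun=> a) b.
Proof.
move=> a0 ab; split => //.
by rewrite (expectation_cst P a) lee_fin.
Qed.

Context {d' : measure_display} {Xi : measurableType d'} {nu : probability Xi R}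
  {I : choiceType} (xi : I -> {RV P >-> Xi}).
Hypothesis xi_iid : iid nu xi.

(** A mean square bound on the compression of deterministic vectors transfers to a
    random matrix that depends only on seeds other than the fresh ones: freeze the
    past by Tonelli's theorem and sum over the rows. *)
Lemma moment_compress n p (cop : Xi -> 'rV[R]_p -> 'rV[R]_p) (a K b : R) (J : seq I)
    (e : 'I_n -> I) (Z : Omega -> 'M[R]_(n, p)) :
  measurable_fun [set: Xi * borel_rV R p]
    (fun z => cop z.1 z.2 : borel_rV R p) ->
  (forall x, 'E_nu[fun z => (frob (a *: cop z x - x) ^+ 2)%R] <=
             (K * frob x ^+ 2)%:E)%E ->
  0 <= K -> uniq J -> (forall i, e i \notin J) ->
  measurable_mx (Z : sigma_seeds xi J -> 'M[R]_(n, p)) ->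
  moment_le (fun w => frob (Z w) ^+ 2) b ->
  moment_le (fun w => frob (a *: compress cop (fun i => xi (e i) w) (Z w) - Z w) ^+ 2)
    (K * b).
Proof.
move=> mcop bound K0 J_uniq eJ mZJ [mZ2 _ Zb].
have mZ : measurable_mx Z.
  move=> i j; apply: (measurableT_comp (mZJ i j)).
  exact: measurable_id_sigma_seeds.
split; [|by move=> w; exact: sqr_ge0|].
  apply: measurable_sqr_frob; apply: measurable_mxB => //; apply: measurable_mxZ.
  by apply: measurable_compress => // i; exact: measurable_funP.
pose h i (z : Xi * sigma_seeds xi J) : \bar R :=
  (frob (a *: cop z.1 (row i (Z z.2)) - row i (Z z.2)) ^+ 2)%:E.
have mh i : measurable_fun setT (h i).
  apply/measurable_EFinP; apply: measurable_sqr_frob.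
  have mr : measurable_mx (fun z : Xi * sigma_seeds xi J => row i (Z z.2)).
    move=> k j; exact: (measurableT_comp (measurable_mx_row i mZJ k j) measurable_snd).
  apply: measurable_mxB => //; apply: measurable_mxZ => k j.
  rewrite ord1; apply: (measurableT_comp (measurable_borel_coord j)).
  apply: (@measurableT_comp _ _ _ _ _ _ (fun z : Xi * borel_rV R p =>
    cop z.1 z.2 : borel_rV R p) _
    (fun z : Xi * sigma_seeds xi J => (z.1, row i (Z z.2) : borel_rV R p))) => //.
  by apply: measurable_fun_pair => //; exact: measurable_borel_row.
have h0 i z : (0 <= h i z)%E by rewrite lee_fin sqr_ge0.
have -> : ('E_P[fun w =>
      (frob (a *: compress cop (fun i => xi (e i) w) (Z w) - Z w) ^+ 2)%R]
    = \sum_i \int[P]_w h i (xi (e i) w, w))%E.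
  rewrite unlock -ge0_integral_sum//; last first.
    move=> i; apply: (measurableT_comp (mh i)).
    apply: measurable_fun_pair; first exact: measurable_funP.
    exact: measurable_id_sigma_seeds.
  apply: eq_integral => w _; rewrite sumEFin; congr EFin.
  rewrite sqr_frob_row; apply: eq_bigr => i _; congr (frob _ ^+ 2).
  by apply/matrixP => k j; rewrite !mxE ord1.
apply: (@le_trans _ _ (\sum_i \int[P]_w (K * frob (row i (Z w)) ^+ 2)%:E)%E).
  apply: lee_sum => i _; rewrite (integral_fresh_seed xi_iid J_uniq (eJ i))//.
  apply: ge0_le_integral => //.
  - by move=> w _; apply: integral_ge0 => z _; exact: h0.
  - apply: (measurableT_comp (measurable_fun_fubini_tonelli_G _ (mh i) (h0 i))).
    exact: measurable_id_sigma_seeds.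
  - apply/measurable_EFinP; apply: measurable_funM => //.
    by apply: measurable_sqr_frob; exact: measurable_mx_row.
  - by move=> w _; have := bound (row i (Z w)); rewrite unlock.
rewrite -ge0_integral_sum//; last 2 first.
- move=> i; apply/measurable_EFinP; apply: measurable_funM => //.
  by apply: measurable_sqr_frob; exact: measurable_mx_row.
- by move=> i w _; rewrite lee_fin mulr_ge0// sqr_ge0.
have [_ _] : moment_le (fun w => K * frob (Z w) ^+ 2) (K * b).
  by apply: moment_leZ => //; split => // w; exact: sqr_ge0.
rewrite unlock; apply: le_trans; rewrite le_eqVlt; apply/orP; left; apply/eqP.
by apply: eq_integral => w _; rewrite sumEFin sqr_frob_row mulr_sumr.
Qed.

End Expectation.

(** * Spectral radius and step sizes *)

Section SpectralRadius.
Context {R : realType} {n : nat}.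

Lemma normr_normc (z : R[i]) : `|z| = (ComplexField.Normc.normc z)%:C%C.
Proof. by case: z. Qed.

(** If [u] is a left eigenvector for [l] then [|l| |u_j| <= sum_i |u_i| A_ij]; pairing
    with [v] gives [|l| sum_j |u_j| v_j <= rho sum_i |u_i| v_i]. *)
Lemma spectral_radius_le (A : 'M[R]_n) (v : 'I_n -> R) (rho : R) :
  (forall i j, 0 <= A i j) -> (forall i, 0 < v i) -> 0 <= rho ->
  (forall i, \sum_j A i j * v j <= rho * v i) -> spectral_radius A <= rho.
Proof.
move=> A0 v0 rho0 Av; rewrite /spectral_radius; set S := (X in sup X).
suff ub : ubound S rho.
  have [->|/set0P S0] := eqVneq S set0; first by rewrite sup0.
  exact: sup_le_ub.
move=> _ [l /eigenvalueP[u ul u0] <-].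
pose m i := ComplexField.Normc.normc (u 0 i).
have mE i : `|u 0 i| = (m i)%:C%C by exact: normr_normc.
have m0 i : 0 <= m i by rewrite -ler0c -mE.
set r := ComplexField.Normc.normc l.
have rE : `|l| = r%:C%C by exact: normr_normc.
have H j : r * m j <= \sum_i m i * A i j.
  rewrite -lecR rmorphM/= -rE -mE -normrM.
  have -> : l * u 0 j = \sum_i u 0 i * (A i j)%:C%C.
    move/matrixP: ul => /(_ 0 j); rewrite !mxE => <-.
    by apply: eq_bigr => i _; rewrite mxE.
  apply: (le_trans (ler_norm_sum _ _ _)).
  rewrite rmorph_sum/=; apply: ler_sum => i _.
  by rewrite normrM mE rmorphM/= ger0_norm ?ler0c.
have mv : 0 < \sum_i m i * v i.
  have [i ui] : exists i, u 0 i != 0.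
    case: (pickP (fun i => u 0 i != 0)) => [i ui|H0]; first by exists i.
    suff u00 : u = 0 by rewrite u00 eqxx in u0.
    by apply/rowP => i; rewrite mxE; apply/eqP/negbFE/H0.
  rewrite (bigD1 i)//= ltr_pwDl//.
    by rewrite mulr_gt0// lt_neqAle m0 andbT -(inj_eq (@complexI R)) -mE eq_sym normr_eq0.
  by apply: sumr_ge0 => k _; rewrite mulr_ge0// ltW.
rewrite -(ler_pM2r mv).
apply: (@le_trans _ _ (\sum_j (\sum_i m i * A i j) * v j)).
  by rewrite mulr_sumr ler_sum// => j _; rewrite mulrA ler_wpM2r// ltW.
under eq_bigr do rewrite mulr_suml.
rewrite exchange_big mulr_sumr ler_sum//= => i _.
under eq_bigr do rewrite -mulrA.
by rewrite -mulr_sumr mulrCA ler_wpM2l.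
Qed.

End SpectralRadius.

Section StepSizes.
Context {R : realFieldType}.
Variables (n mu L kappa s gamma eta : R) (eps1 eps2 eps3 eps4 eps5 : R).
Hypotheses (n_gt0 : 0 < n) (mu_gt0 : 0 < mu) (L_ge0 : 0 <= L) (mu_le_L : mu <= L).
Hypotheses (s_le1 : s <= 1) (gamma_gt0 : 0 < gamma) (gamma_le1 : gamma <= 1).
Hypothesis L_kappa : L = kappa * mu.
Hypothesis eta_gt0 : 0 < eta.
Hypotheses (eps1_gt0 : 0 < eps1) (eps2_gt0 : 0 < eps2) (eps3_gt0 : 0 < eps3)
  (eps4_gt0 : 0 < eps4) (eps5_gt0 : 0 < eps5).
Let S := 2 * n * eps1 + 2 * eps2 + eps3.
Hypothesis eta_le1 : eta <= s * eps2 / (4 * kappa * eps3) * (gamma / L).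
Hypothesis eta_le2 : eta <= s * eps3 / (12 * kappa * S) * (gamma / L).

Let L_gt0 : 0 < L. Proof. exact: lt_le_trans mu_le_L. Qed.
Let kappa_gt0 : 0 < kappa.
Proof. by have := L_gt0; rewrite L_kappa pmulr_lgt0. Qed.
Let kappa_ge1 : 1 <= kappa.
Proof. by move: mu_le_L; rewrite L_kappa -[leLHS]mul1r ler_pM2r. Qed.
Let etaL : eta * L = kappa * (eta * mu).
Proof. by rewrite L_kappa mulrCA. Qed.

(** The upper bound on [eta] has the sign of [s]; a positive step size thus forces a
    positive spectral gap. *)
Lemma spectral_gap_gt0 : 0 < s.
Proof.
have := lt_le_trans eta_gt0 eta_le1.
have -> : s * eps2 / (4 * kappa * eps3) * (gamma / L) =
    (eps2 / (4 * kappa * eps3) * (gamma / L)) * s by ring.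
rewrite pmulr_rgt0 //; apply: mulr_gt0; last exact: divr_gt0.
by apply: divr_gt0 => //; rewrite !mulr_gt0.
Qed.
Let s_gt0 := spectral_gap_gt0.

Let eta1 : 4 * kappa * eps3 * (eta * L) <= s * eps2 * gamma.
Proof.
have k0 : 0 < 4 * kappa * eps3 * L by rewrite !mulr_gt0.
have := ler_wpM2l (ltW k0) eta_le1.
have -> : 4 * kappa * eps3 * L * (s * eps2 / (4 * kappa * eps3) * (gamma / L)) =
    s * eps2 * gamma by field; rewrite !lt0r_neq0.
by apply: le_trans; rewrite le_eqVlt; apply/orP; left; apply/eqP; ring.
Qed.

Let S_gt0 : 0 < S. Proof. by rewrite !addr_gt0 ?mulr_gt0. Qed.

Let eta2 : 12 * kappa * S * (eta * L) <= s * eps3 * gamma.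
Proof.
have k0 : 0 < 12 * kappa * S * L by rewrite !mulr_gt0.
have := ler_wpM2l (ltW k0) eta_le2.
have -> : 12 * kappa * S * L * (s * eps3 / (12 * kappa * S) * (gamma / L)) =
    s * eps3 * gamma by field; rewrite !lt0r_neq0.
by apply: le_trans; rewrite le_eqVlt; apply/orP; left; apply/eqP; ring.
Qed.

Let eta3 : 12 * kappa * (eta * L) <= s * gamma.
Proof.
have uL : 0 < eta * L by rewrite mulr_gt0.
have k0 : 0 < 12 * kappa * (eta * L) by rewrite !mulr_gt0.
rewrite -(ler_pM2r eps3_gt0).
apply: (@le_trans _ _ (12 * kappa * (eta * L) * S)).
  by rewrite ler_pM2l// /S lerDr addr_ge0 ?mulr_ge0 ?ltW.
by rewrite mulrAC; apply: (le_trans eta2); rewrite mulrAC.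
Qed.

Let x_gt0 : 0 < eta * mu. Proof. by rewrite mulr_gt0. Qed.
Let sg_gt0 : 0 < s * gamma. Proof. by rewrite mulr_gt0. Qed.
Let sg_le1 : s * gamma <= 1.
Proof. by rewrite -[leRHS]mulr1; apply: ler_pM => //; exact: ltW. Qed.

(** Since [S >= eps3] and [kappa >= 1], the second bound on [eta] makes [eta L] and
    [eta mu] small compared with [s gamma]. *)
Lemma etaL_le : 12 * (eta * L) <= s * gamma.
Proof.
apply: le_trans eta3; rewrite -mulrA ler_pM2l// ler_peMl// mulr_ge0// ltW//.
Qed.

Lemma etamu_le : 12 * (eta * mu) <= s * gamma.
Proof. by apply: le_trans etaL_le; rewrite ler_pM2l// ler_pM2l. Qed.

Lemma etamu_le12 : eta * mu <= 1 / 12.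
Proof. by have := sg_le1; have := etamu_le; lra. Qed.

Lemma eta2L2_le : eta ^+ 2 * L ^+ 2 <= eta * mu / 12.
Proof.
have -> : eta ^+ 2 * L ^+ 2 = (kappa * (eta * L)) * (eta * mu).
  by rewrite -exprMn expr2 {2}etaL; ring.
by rewrite [leRHS]mulrC ler_pM2r//; have := sg_le1; have := eta3; lra.
Qed.

Lemma etaL_le_gamma : eta * L <= gamma.
Proof.
have := etaL_le; have : s * gamma <= gamma by rewrite ler_piMl// ltW.
by have := gamma_gt0; lra.
Qed.

(** First of the five components of [A v <= (1 - eta mu / 2) v], for the vector
    [v = (eps1, eps2, L^2 eps3, eps4, L^2 eps5)]. *)
Lemma row_optimality : 3 * kappa ^+ 2 * eps2 <= n * eps1 ->
  (1 - 3 / 2 * eta * mu) * eps1 + 3 * eta * L ^+ 2 / (mu * n) * eps2 <=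
  (1 - 1 / 2 * eta * mu) * eps1.
Proof.
move=> H.
have -> : 3 * eta * L ^+ 2 / (mu * n) * eps2 =
    eta * mu / n * (3 * kappa ^+ 2 * eps2).
  by rewrite L_kappa; field; rewrite !lt0r_neq0.
have k0 : 0 <= eta * mu / n by rewrite divr_ge0 ?ltW.
have := ler_wpM2l k0 H.
have -> : eta * mu / n * (n * eps1) = eta * mu * eps1.
  by field; rewrite lt0r_neq0.
lra.
Qed.

Let contraction e : 0 <= e ->
  (1 + (1 - gamma * s) ^+ 2) / 2 * e <= (1 - s * gamma / 2) * e.
Proof.
move=> e0; apply: ler_wpM2r => //.
have q : (s * gamma) ^+ 2 <= s * gamma by rewrite expr2 ler_piMl ?(ltW sg_gt0).
by move: q; lra.
Qed.

(** Gossip gains [s gamma / 2].  Half of it pays for the compression error, by the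
    condition on [eps4]; the first bound on [eta] keeps the tracking term below
    [eta mu / 2], and [eta mu <= s gamma / 12] leaves the required margin. *)
Lemma row_consensus c2 : 2 * (2 / s) * c2 * eps4 <= eps2 ->
  (1 + (1 - gamma * s) ^+ 2) / 2 * eps2
  + 2 / s * (eta ^+ 2 / gamma) * (L ^+ 2 * eps3) + c2 * gamma * eps4 <=
  (1 - 1 / 2 * eta * mu) * eps2.
Proof.
move=> H.
have T4 : c2 * gamma * eps4 <= s * gamma / 4 * eps2.
  have k0 : 0 <= s * gamma / 4 by rewrite divr_ge0 ?ltW.
  have := ler_wpM2l k0 H.
  have -> : s * gamma / 4 * (2 * (2 / s) * c2 * eps4) = c2 * gamma * eps4.
    by field; rewrite lt0r_neq0.
  by [].
have T3 : 2 / s * (eta ^+ 2 / gamma) * (L ^+ 2 * eps3) <= eta * mu / 2 * eps2.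
  have k0 : 0 <= eta * L / (2 * kappa * s * gamma).
    by rewrite divr_ge0 ?mulr_ge0 ?(ltW s_gt0) ?(ltW kappa_gt0) ?(ltW eta_gt0) ?(ltW gamma_gt0).
  have := ler_wpM2l k0 eta1.
  have -> : eta * L / (2 * kappa * s * gamma) * (4 * kappa * eps3 * (eta * L)) =
      2 / s * (eta ^+ 2 / gamma) * (L ^+ 2 * eps3).
    by field; rewrite !lt0r_neq0.
  have -> : eta * L / (2 * kappa * s * gamma) * (s * eps2 * gamma) =
      eta * mu / 2 * eps2.
    by rewrite etaL; field; rewrite !lt0r_neq0.
  by [].
have T2 := contraction (ltW eps2_gt0).
have := ler_wpM2r (ltW eps2_gt0) etamu_le.
have : 0 <= s * gamma * eps2 by rewrite mulr_ge0 ?ltW.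
lra.
Qed.

(** Same budget after division by [L^2]: half of the gain [s gamma / 2] pays for [m2],
    and the second bound on [eta] keeps the terms in [eta^2] below [eta mu / 2]. *)
Lemma row_tracking c2 c4 : 4 * (c4 * eps2 + c2 * (3 * eps4 + eps5)) / s <= eps3 ->
  n * (12 * L ^+ 2 / s) * L ^+ 2 * (eta ^+ 2 / gamma) * eps1
  + (12 * L ^+ 2 / s * L ^+ 2 * (eta ^+ 2 / gamma) + c4 * L ^+ 2 * gamma) * eps2
  + ((1 + (1 - gamma * s) ^+ 2) / 2 + 1 / 2 * (12 * L ^+ 2 / s) * (eta ^+ 2 / gamma))
    * (L ^+ 2 * eps3)
  + 3 * c2 * L ^+ 2 * gamma * eps4 + c2 * gamma * (L ^+ 2 * eps5) <=
  (1 - 1 / 2 * eta * mu) * (L ^+ 2 * eps3).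
Proof.
set m2 := c4 * eps2 + _ => H.
have T1 : m2 * gamma <= s * gamma / 4 * eps3.
  have k0 : 0 <= s * gamma / 4 by rewrite divr_ge0 ?ltW.
  have := ler_wpM2l k0 H.
  have -> : s * gamma / 4 * (4 * m2 / s) = m2 * gamma.
    by field; rewrite lt0r_neq0.
  by [].
have T2 : 6 * L ^+ 2 / s * (eta ^+ 2 / gamma) * S <= eta * mu / 2 * eps3.
  have k0 : 0 <= eta * L / (2 * kappa * s * gamma).
    by rewrite divr_ge0 ?mulr_ge0 ?(ltW s_gt0) ?(ltW kappa_gt0) ?(ltW eta_gt0) ?(ltW gamma_gt0).
  have := ler_wpM2l k0 eta2.
  have -> : eta * L / (2 * kappa * s * gamma) * (12 * kappa * S * (eta * L)) =
      6 * L ^+ 2 / s * (eta ^+ 2 / gamma) * S.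
    by field; rewrite !lt0r_neq0.
  have -> : eta * L / (2 * kappa * s * gamma) * (s * eps3 * gamma) =
      eta * mu / 2 * eps3.
    by rewrite etaL; field; rewrite !lt0r_neq0.
  by [].
have T3 := contraction (ltW eps3_gt0).
have T5 := ler_wpM2r (ltW eps3_gt0) etamu_le.
have T6 : 0 <= s * gamma * eps3 by rewrite mulr_ge0 ?ltW.
set r := (1 + _ ^+ 2) / 2 in T3 *.
have E : r * eps3 + 6 * L ^+ 2 / s * (eta ^+ 2 / gamma) * S + m2 * gamma <=
    (1 - 1 / 2 * eta * mu) * eps3 by lra.
apply: le_trans (_ : _ <= L ^+ 2 * ((1 - 1 / 2 * eta * mu) * eps3)) _; last first.
  by rewrite mulrCA.
apply: le_trans (ler_wpM2l (sqr_ge0 L) E).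
rewrite le_eqVlt; apply/orP; left; apply/eqP; rewrite /m2 /S; by field; rewrite !lt0r_neq0.
Qed.

Let gamma2 : gamma ^+ 2 <= gamma. Proof. by rewrite expr2 ler_piMl// ltW. Qed.
Let eta2L2 : L ^+ 2 * eta ^+ 2 <= gamma ^+ 2.
Proof.
rewrite mulrC -exprMn ler_pXn2r ?nnegrE ?mulr_ge0 ?(ltW eta_gt0) ?(ltW gamma_gt0)//.
exact: etaL_le_gamma.
Qed.
Let half_rate e : 0 <= e -> 1 / 2 * eta * mu * e <= gamma * (e / (2 * kappa)).
Proof.
move=> e0; have -> : 1 / 2 * eta * mu * e = eta * L * (e / (2 * kappa)).
  by rewrite etaL; field; rewrite lt0r_neq0.
apply: ler_wpM2r; last exact: etaL_le_gamma.
by rewrite divr_ge0// mulr_ge0// ltW.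
Qed.

(** Since [gamma <= 1] and [eta L <= gamma], every term beyond [cx] is at most [gamma]
    times the corresponding term of [m3]. *)
Lemma row_compression tx c5 c6 cx : 0 <= tx -> 0 <= c5 -> 0 <= c6 ->
  let m3 := tx * S + c5 * eps2 + c6 * eps4 + eps4 / (2 * kappa) in
  gamma <= (1 - cx) / m3 * eps4 ->
  2 * n * tx * L ^+ 2 * eta ^+ 2 * eps1
  + (c5 * gamma ^+ 2 + 2 * tx * L ^+ 2 * eta ^+ 2) * eps2
  + tx * eta ^+ 2 * (L ^+ 2 * eps3) + (cx + c6 * gamma ^+ 2) * eps4 <=
  (1 - 1 / 2 * eta * mu) * eps4.
Proof.
move=> tx0 c50 c60 m3 H.
have m30 : 0 < m3.
  rewrite /m3 ltr_wpDl ?divr_gt0 ?mulr_gt0//.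
  by rewrite !addr_ge0 ?mulr_ge0 ?(ltW S_gt0) ?(ltW eps2_gt0) ?(ltW eps4_gt0).
have {H} H : gamma * m3 <= (1 - cx) * eps4.
  have := ler_wpM2r (ltW m30) H.
  have -> : (1 - cx) / m3 * eps4 * m3 = (1 - cx) * eps4 by field; rewrite lt0r_neq0.
  by [].
have T1 : L ^+ 2 * eta ^+ 2 * (tx * S) <= gamma * (tx * S).
  by apply: ler_wpM2r; [rewrite mulr_ge0// ltW|exact: le_trans eta2L2 gamma2].
have T2 : gamma ^+ 2 * (c5 * eps2 + c6 * eps4) <= gamma * (c5 * eps2 + c6 * eps4).
  by apply: ler_wpM2r => //; rewrite addr_ge0 ?mulr_ge0 ?(ltW eps2_gt0) ?(ltW eps4_gt0).
have T3 := half_rate (ltW eps4_gt0).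
move: H T1 T2 T3; rewrite /m3 /S; lra.
Qed.

Lemma row_tracking_compression ty c7 c8 cy : 0 <= ty -> 0 <= c7 -> 0 <= c8 ->
  let m4 := 3 * ty * S + 3 * c8 * eps2 + c8 * eps3 + 3 * c7 * eps4 + c7 * eps5
            + eps5 / (2 * kappa) in
  gamma <= (1 - cy) / m4 * eps5 ->
  6 * n * ty * L ^+ 4 * eta ^+ 2 * eps1
  + (3 * c8 * L ^+ 2 * gamma ^+ 2 + 6 * ty * L ^+ 4 * eta ^+ 2) * eps2
  + (3 * ty * L ^+ 2 * eta ^+ 2 + c8 * gamma ^+ 2) * (L ^+ 2 * eps3)
  + 3 * c7 * L ^+ 2 * gamma ^+ 2 * eps4 + (cy + c7 * gamma ^+ 2) * (L ^+ 2 * eps5) <=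
  (1 - 1 / 2 * eta * mu) * (L ^+ 2 * eps5).
Proof.
move=> ty0 c70 c80 m4 H.
pose q := 3 * c8 * eps2 + c8 * eps3 + 3 * c7 * eps4 + c7 * eps5.
have q0 : 0 <= q.
  by rewrite !addr_ge0 ?mulr_ge0 ?(ltW eps2_gt0) ?(ltW eps3_gt0) ?(ltW eps4_gt0)
    ?(ltW eps5_gt0).
have m4E : m4 = 3 * ty * S + q + eps5 / (2 * kappa) by rewrite /m4 /q; ring.
have tS : 0 <= 3 * ty * S by rewrite !mulr_ge0 ?(ltW S_gt0).
have m40 : 0 < m4.
  by rewrite m4E ltr_wpDl ?divr_gt0 ?mulr_gt0// addr_ge0.
have {H} H : gamma * m4 <= (1 - cy) * eps5.
  have := ler_wpM2r (ltW m40) H.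
  have -> : (1 - cy) / m4 * eps5 * m4 = (1 - cy) * eps5 by field; rewrite lt0r_neq0.
  by [].
have T1 : L ^+ 2 * eta ^+ 2 * (3 * ty * S) <= gamma * (3 * ty * S).
  by apply: ler_wpM2r => //; exact: le_trans eta2L2 gamma2.
have T2 : gamma ^+ 2 * q <= gamma * q by exact: ler_wpM2r.
have T3 := half_rate (ltW eps5_gt0).
have E : L ^+ 2 * eta ^+ 2 * (3 * ty * S) + gamma ^+ 2 * q + cy * eps5 <=
    (1 - 1 / 2 * eta * mu) * eps5.
  by move: H; rewrite m4E; lra.
apply: le_trans (_ : _ <= L ^+ 2 * ((1 - 1 / 2 * eta * mu) * eps5)) _; last first.
  by rewrite mulrCA.
apply: le_trans (ler_wpM2l (sqr_ge0 L) E).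
rewrite le_eqVlt; apply/orP; left; apply/eqP; rewrite /q /S; ring.
Qed.

End StepSizes.

(** * The recursion on the five errors *)

(** Hypotheses are tried first, because a local definition whose sign is known may unfold
    to a sum or a product that must not be decomposed. *)
Ltac nonneg := repeat first
  [ assumption | exact: ler01 | exact: ler0n | exact: sqr_ge0
  | apply: ltW; assumption | rewrite invr_ge0 | apply: exprn_ge0 | apply: addr_ge0
  | apply: mulr_ge0 ].

Section Recursion.
Context {R : realType} {n p : nat}.
Hypothesis n_gt0 : (0 < n)%N.
Variables (W : 'M[R]_n) (f : 'I_n -> 'rV[R]_p -> R) (mu L : R) (xstar : 'rV[R]_p).
Hypothesis W_stoch : doubly_stochastic W.
Hypothesis f_diff : forall i x, differentiable (f i) x.
Hypotheses (mu_gt0 : 0 < mu) (L_ge0 : 0 <= L).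
Hypothesis f_convex : strongly_convex mu (average f).
Hypothesis f_lip : forall i, lipschitz_grad L (f i).
Hypothesis grad_xstar : grad (average f) xstar = 0.

Variables (C r delta : R).
Hypotheses (C_ge0 : 0 <= C) (r_gt0 : 0 < r) (delta_le1 : delta <= 1).
Context {d d' : measure_display} {Omega : measurableType d} {P : probability Omega R}
  {Xi : measurableType d'} {nu : probability Xi R}.
Variable cop : Xi -> 'rV[R]_p -> 'rV[R]_p.
Hypothesis cop_compr : compressor nu C r delta cop.
Variable xi : (bool * nat * 'I_n)%type -> {RV P >-> Xi}.
Hypothesis xi_iid : iid nu xi.

Variables (X0 Hx0 Hy0 : 'M[R]_(n, p)) (alphax alphay gamma eta : R) (taux tauy : R).
Hypotheses (alphax_r : 0 <= alphax * r <= 1) (alphay_r : 0 <= alphay * r <= 1).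
Hypotheses (taux_gt1 : 1 < taux) (tauy_gt1 : 1 < tauy).

Let s : R := 1 - spectral_norm (W - n%:R^-1 *: const_mx 1).
Let N : R := spectral_norm (1%:M - W).
Hypothesis s_gt0 : 0 < s.
Hypotheses (gamma_gt0 : 0 < gamma) (gamma_le1 : gamma <= 1) (eta_gt0 : 0 < eta).
Hypothesis etaL : eta ^+ 2 * L ^+ 2 <= eta * mu / 12.
Hypothesis etamu : eta * mu <= 1 / 12.

Let state k w := cgt f W cop alphax alphay gamma eta
  (fun i => xi i : Omega -> Xi) X0 Hx0 Hy0 k w.
Let X k w := st_X (state k w).
Let Hx k w := st_Hx (state k w).
Let Y k w := st_Y (state k w).
Let Hy k w := st_Hy (state k w).
Let Qx k w := compress cop (fun i => xi (true, k, i) w) (X k w - Hx k w).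
Let Qy k w := compress cop (fun i => xi (false, k, i) w) (Y k w - Hy k w).

Lemma state_succ k w : state k.+1 w =
  let X' := X k w - gamma *: ((1%:M - W) *m (Hx k w + Qx k w)) - eta *: Y k w in
  CGTState X' ((1 - alphax) *: Hx k w + alphax *: (Hx k w + Qx k w))
    (Y k w - gamma *: ((1%:M - W) *m (Hy k w + Qy k w))
     + stacked_grad f X' - stacked_grad f (X k w))
    ((1 - alphay) *: Hy k w + alphay *: (Hy k w + Qy k w)).
Proof.
by rewrite /state /= /cgt_step /X /Hx /Y /Hy /Qx /Qy /X /Hx /Y /Hy /state; case: cgt.
Qed.

Lemma gradient_tracking k w : row_mean (Y k w) = row_mean (stacked_grad f (X k w)).
Proof.
elim: k => [//|k IH]; rewrite /Y /X state_succ/=; exact: tracking_step.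
Qed.

(** Duplicate-free, as mutual independence is stated for lists without repetition. *)
Definition past k : seq (bool * nat * 'I_n) :=
  undup [seq (bl, i) | bl <- [seq (b, l) | b <- [:: true; false], l <- iota 0 k],
                       i <- enum 'I_n].

Lemma mem_past b l i k : ((b, l, i) \in past k) = (l < k)%N.
Proof.
rewrite mem_undup; apply/allpairsP/idP => [[[bl i'] /= [H _ [E _]]]|lk].
  move: H; rewrite -E !mem_cat orbF.
  by case/orP => /mapP[l' + [_ ->]]; rewrite mem_iota.
exists (b, l, i); split; rewrite ?mem_enum//=.
have Hl c : (c, l) \in [seq (c, l') | l' <- iota 0 k].
  by apply: map_f; rewrite mem_iota.
by rewrite !mem_cat; case: b; rewrite Hl ?orbT.
Qed.

Let mcop : measurable_fun [set: Xi * borel_rV R p]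
  (fun z => cop z.1 z.2 : borel_rV R p).
Proof. by case: cop_compr. Qed.

Let meas_state k : [/\ measurable_mx (X k), measurable_mx (Hx k),
  measurable_mx (Y k) & measurable_mx (Hy k)].
Proof.
apply: (measurable_cgt W alphax alphay gamma eta X0 Hx0 Hy0 L_ge0 f_lip mcop).
by move=> b l i _; exact: measurable_funP.
Qed.

Let past_state k : let T := sigma_seeds xi (past k) in
  [/\ measurable_mx (X k : T -> _), measurable_mx (Hx k : T -> _),
  measurable_mx (Y k : T -> _) & measurable_mx (Hy k : T -> _)].
Proof.
apply: (measurable_cgt W alphax alphay gamma eta X0 Hx0 Hy0 L_ge0 f_lip mcop).
move=> b l i lk.
by apply: measurable_sigma_seeds; rewrite mem_past.
Qed.

Let o k w := frob (row_mean (X k w) - xstar) ^+ 2.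
Let c k w := frob (deviation (X k w)) ^+ 2.
Let g k w := frob (deviation (Y k w)) ^+ 2.
Let cx k w := frob (X k w - Hx k w) ^+ 2.
Let cy k w := frob (Y k w - Hy k w) ^+ 2.
Let ex k w := frob (Hx k w + Qx k w - X k w) ^+ 2.
Let ey k w := frob (Hy k w + Qy k w - Y k w) ^+ 2.
Let dx k w := frob (r^-1 *: Qx k w - (X k w - Hx k w)) ^+ 2.
Let dy k w := frob (r^-1 *: Qy k w - (Y k w - Hy k w)) ^+ 2.

Let fresh b k i : (b, k, i) \notin past k. Proof. by rewrite mem_past ltnn. Qed.

Lemma moment_ex k b : moment_le P (cx k) b -> moment_le P (ex k) (C * b).
Proof.
have [mX mHx _ _] := past_state k => H.
have -> : ex k = fun w => frob (1 *: Qx k w - (X k w - Hx k w)) ^+ 2.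
  by apply/funext => w; rewrite /ex scale1r opprB addrA [Qx k w + _]addrC.
apply: (moment_compress xi_iid mcop _ C_ge0 (undup_uniq _) (fresh true k) _ H).
  by move=> x; under [X in ('E_nu[X] <= _)%E]eq_fun do rewrite scale1r; case: cop_compr.
exact: measurable_mxB.
Qed.

Lemma moment_ey k b : moment_le P (cy k) b -> moment_le P (ey k) (C * b).
Proof.
have [_ _ mY mHy] := past_state k => H.
have -> : ey k = fun w => frob (1 *: Qy k w - (Y k w - Hy k w)) ^+ 2.
  by apply/funext => w; rewrite /ey scale1r opprB addrA [Qy k w + _]addrC.
apply: (moment_compress xi_iid mcop _ C_ge0 (undup_uniq _) (fresh false k) _ H).
  by move=> x; under [X in ('E_nu[X] <= _)%E]eq_fun do rewrite scale1r; case: cop_compr.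
exact: measurable_mxB.
Qed.

Let delta1 : 0 <= 1 - delta. Proof. by rewrite subr_ge0. Qed.

Lemma moment_dx k b : moment_le P (cx k) b -> moment_le P (dx k) ((1 - delta) * b).
Proof.
have [mX mHx _ _] := past_state k => H.
apply: (moment_compress xi_iid mcop _ delta1 (undup_uniq _) (fresh true k) _ H).
  by case: cop_compr.
exact: measurable_mxB.
Qed.

Lemma moment_dy k b : moment_le P (cy k) b -> moment_le P (dy k) ((1 - delta) * b).
Proof.
have [_ _ mY mHy] := past_state k => H.
apply: (moment_compress xi_iid mcop _ delta1 (undup_uniq _) (fresh false k) _ H).
  by case: cop_compr.
exact: measurable_mxB.
Qed.

Variables (rho e1 e2 e3 e4 e5 : R).
Hypotheses (rho_ge0 : 0 <= rho) (e1_gt0 : 0 < e1) (e2_gt0 : 0 < e2) (e3_gt0 : 0 < e3)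
  (e4_gt0 : 0 < e4) (e5_gt0 : 0 < e5).
Let disp := 6 * n%:R * L ^+ 2 * eta ^+ 2 * e1
  + (6 * L ^+ 2 * eta ^+ 2 + 3 * gamma ^+ 2 * N ^+ 2) * e2
  + 3 * eta ^+ 2 * e3 + 3 * gamma ^+ 2 * N ^+ 2 * (C * e4).
Hypothesis row1 :
  (1 - 3 / 2 * eta * mu) * e1 + 3 * eta * L ^+ 2 / (mu * n%:R) * e2 <= rho * e1.
Hypothesis row2 :
  (1 + (1 - gamma * s) ^+ 2) / 2 * e2 + 2 / s * (eta ^+ 2 / gamma) * e3
  + 2 / s * N ^+ 2 * gamma * (C * e4) <= rho * e2.
Hypothesis row3 :
  (1 + (1 - gamma * s) ^+ 2) / 2 * e3 + 2 / s * N ^+ 2 * gamma * (C * e5)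
  + 2 / (gamma * s) * L ^+ 2 * disp <= rho * e3.
Hypothesis row4 :
  taux * (1 - alphax * r * delta) * e4 + taux / (taux - 1) * disp <= rho * e4.
Hypothesis row5 :
  tauy * (1 - alphay * r * delta) * e5
  + tauy / (tauy - 1) * (3 * gamma ^+ 2 * N ^+ 2 * e3
    + 3 * gamma ^+ 2 * N ^+ 2 * (C * e5) + 3 * L ^+ 2 * disp) <= rho * e5.

(** Errors in units of the weights [e1, ..., e5], which one iteration multiplies by at
    most [rho] according to [row1] to [row5]. *)
Definition moments_bounded k K :=
  [/\ moment_le P (o k) (K * e1), moment_le P (c k) (K * e2),
      moment_le P (g k) (K * e3), moment_le P (cx k) (K * e4) &
      moment_le P (cy k) (K * e5)].

Lemma moments_step k K : 0 <= K ->
  moments_bounded k K -> moments_bounded k.+1 (K * rho).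
Proof.
move=> K0 [Ho Hc Hg Hcx Hcy].
have Hex := moment_ex Hcx; have Hey := moment_ey Hcy.
have Hdx := moment_dx Hcx; have Hdy := moment_dy Hcy.
have track := gradient_tracking k.
have [mX mHx mY mHy] := meas_state k.
have [mX' mHx' mY' mHy'] := meas_state k.+1.
have N0 : 0 <= N by exact: spectral_norm_ge0.
have n0 : 0 < n%:R :> R by rewrite ltr0n.
have wL : 0 <= 6 * n%:R * L ^+ 2 * eta ^+ 2 by nonneg.
have wD : 0 <= 6 * L ^+ 2 * eta ^+ 2 + 3 * gamma ^+ 2 * N ^+ 2 by nonneg.
have wE : 0 <= 3 * eta ^+ 2 by nonneg.
have wG : 0 <= 3 * gamma ^+ 2 * N ^+ 2 by nonneg.
have wr : 0 <= (1 + (1 - gamma * s) ^+ 2) / 2 by nonneg.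
have Hdisp : moment_le P (fun w => frob (X k.+1 w - X k w) ^+ 2) (K * disp).
  apply: moment_leW (moment_leD (moment_leD (moment_leD (moment_leZ wL Ho)
    (moment_leZ wD Hc)) (moment_leZ wE Hg)) (moment_leZ wG Hex)).
  - by apply: measurable_sqr_frob; exact: measurable_mxB.
  - by move=> w; exact: sqr_ge0.
  - move=> w; rewrite {1}/X state_succ/=.
    exact: displacement.
  - by rewrite /disp; lra.
have HdispY : moment_le P (fun w => frob (Y k.+1 w - Y k w) ^+ 2)
    (K * (3 * gamma ^+ 2 * N ^+ 2 * e3 + 3 * gamma ^+ 2 * N ^+ 2 * (C * e5)
     + 3 * L ^+ 2 * disp)).
  have w3 : 0 <= 3 * L ^+ 2 by rewrite mulr_ge0// sqr_ge0.
  apply: moment_leW (moment_leD (moment_leD (moment_leZ wG Hg)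
    (moment_leZ wG Hey)) (moment_leZ w3 Hdisp)).
  - by apply: measurable_sqr_frob; exact: measurable_mxB.
  - by move=> w; exact: sqr_ge0.
  - move=> w; rewrite {1}/Y {1}/X state_succ/=.
    exact: tracking_displacement.
  - by lra.
split.
- have w1 : 0 <= 1 - 3 / 2 * eta * mu by have := etamu; lra.
  have w2 : 0 <= 3 * eta * L ^+ 2 / (mu * n%:R) by nonneg.
  apply: moment_leW (moment_leD (moment_leZ w1 Ho) (moment_leZ w2 Hc)).
  + apply: measurable_sqr_frob; apply: measurable_mxB; first exact: measurable_row_mean.
    exact: measurable_mx_cst.
  + by move=> w; exact: sqr_ge0.
  + move=> w; rewrite /o {1}/X state_succ/=.
    exact: optimality_step.
  + by have := ler_wpM2l K0 row1; lra.
- have w1 : 0 <= 2 / s * (eta ^+ 2 / gamma) by nonneg.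
  have w2 : 0 <= 2 / s * N ^+ 2 * gamma by nonneg.
  apply: moment_leW (moment_leD (moment_leD (moment_leZ wr Hc) (moment_leZ w1 Hg))
    (moment_leZ w2 Hex)).
  + by apply: measurable_sqr_frob; exact: measurable_deviation.
  + by move=> w; exact: sqr_ge0.
  + move=> w; rewrite /c {1}/X state_succ/=.
    exact: consensus_step.
  + by have := ler_wpM2l K0 row2; lra.
- have w1 : 0 <= 2 / (gamma * s) * L ^+ 2 by nonneg.
  have w2 : 0 <= 2 / s * N ^+ 2 * gamma by nonneg.
  apply: moment_leW (moment_leD (moment_leD (moment_leZ wr Hg) (moment_leZ w2 Hey))
    (moment_leZ w1 Hdisp)).
  + by apply: measurable_sqr_frob; exact: measurable_deviation.
  + by move=> w; exact: sqr_ge0.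
  + move=> w; rewrite /g {1}/Y {1}/X state_succ/=.
    exact: tracking_error_step.
  + by have := ler_wpM2l K0 row3; lra.
- have t0 : 0 <= taux by rewrite ltW// (lt_trans _ taux_gt1).
  have t1 : 0 <= taux / (taux - 1) by rewrite divr_ge0// subr_ge0 ltW.
  have /andP[a0 a1] := alphax_r; have a1' : 0 <= 1 - alphax * r by rewrite subr_ge0.
  apply: moment_leW (moment_leD (moment_leZ t0 (moment_leD (moment_leZ a1' Hcx)
    (moment_leZ a0 Hdx))) (moment_leZ t1 Hdisp)).
  + by apply: measurable_sqr_frob; exact: measurable_mxB.
  + by move=> w; exact: sqr_ge0.
  + move=> w; rewrite /cx [Hx k.+1 w]/Hx state_succ/=.
    exact: compression_step.
  + by have := ler_wpM2l K0 row4; lra.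
- have t0 : 0 <= tauy by rewrite ltW// (lt_trans _ tauy_gt1).
  have t1 : 0 <= tauy / (tauy - 1) by rewrite divr_ge0// subr_ge0 ltW.
  have /andP[a0 a1] := alphay_r; have a1' : 0 <= 1 - alphay * r by rewrite subr_ge0.
  apply: moment_leW (moment_leD (moment_leZ t0 (moment_leD (moment_leZ a1' Hcy)
    (moment_leZ a0 Hdy))) (moment_leZ t1 HdispY)).
  + by apply: measurable_sqr_frob; exact: measurable_mxB.
  + by move=> w; exact: sqr_ge0.
  + move=> w; rewrite /cy [Hy k.+1 w]/Hy state_succ/=.
    exact: compression_step.
  + by have := ler_wpM2l K0 row5; lra.
Qed.

(** The initial errors are constants, so the sum of their ratios to the weights is an
    admissible [M]. *)
Lemma moments_decay : exists2 M, 0 <= M & forall k, moments_bounded k (M * rho ^+ k).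
Proof.
pose w0 : Omega := point.
exists (o 0 w0 / e1 + c 0 w0 / e2 + g 0 w0 / e3 + cx 0 w0 / e4 + cy 0 w0 / e5).
  by rewrite !addr_ge0// divr_ge0 ?sqr_ge0// ltW.
set M := _ + _.
have base (phi : Omega -> R) e : (forall w, phi w = phi w0) -> 0 <= phi w0 ->
    0 < e -> phi w0 / e <= M -> moment_le P phi (M * e).
  move=> E phi0 e0; rewrite ler_pdivrMr// => le.
  have -> : phi = fun=> phi w0 by apply/funext.
  exact: moment_le_cst.
have pos (x e : R) : 0 <= x -> 0 < e -> 0 <= x / e.
  by move=> x0 e0; rewrite divr_ge0// ltW.
have po := pos _ _ (sqr_ge0 _ : 0 <= o 0 w0) e1_gt0.
have pc := pos _ _ (sqr_ge0 _ : 0 <= c 0 w0) e2_gt0.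
have pg := pos _ _ (sqr_ge0 _ : 0 <= g 0 w0) e3_gt0.
have px := pos _ _ (sqr_ge0 _ : 0 <= cx 0 w0) e4_gt0.
have py := pos _ _ (sqr_ge0 _ : 0 <= cy 0 w0) e5_gt0.
elim=> [|k IH].
  rewrite expr0 mulr1; split; apply: base => //; first [exact: sqr_ge0 | rewrite /M; lra].
have K0 : 0 <= M * rho ^+ k.
  by rewrite mulr_ge0 ?exprn_ge0// !addr_ge0.
by rewrite exprSr mulrA; exact: moments_step.
Qed.

End Recursion.

(** * Linear convergence *)

Lemma cvge_geometric_bound (R : realType) (u : nat -> \bar R) (M q : R) :
  (forall k, 0 <= u k)%E -> (forall k, u k <= (M * q ^+ k)%:E)%E ->
  0 <= q < 1 -> u k @[k --> \oo] --> 0%E.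
Proof.
move=> u0 uM /andP[q0 q1].
apply: (@squeeze_cvge _ _ _ _ (cst 0%E) _ (fun k => (M * q ^+ k)%:E)).
- by near=> k; rewrite u0 uM.
- exact: cvg_cst.
- apply/cvg_EFin => //; first by near=> k.
  rewrite -[X in _ --> X](mulr0 M); apply: cvgM; first exact: cvg_cst.
  by apply: cvg_expr; rewrite ger0_norm.
Unshelve. all: by end_near. Qed.

Lemma rate_bounds (R : realType) (eta mu : R) : 0 < eta * mu -> eta * mu <= 1 / 12 ->
  [/\ 0 <= 1 - 3 / 2 * eta * mu, 0 <= 1 - 1 / 2 * eta * mu & 1 - 1 / 2 * eta * mu < 1].
Proof. by move=> x0 x1; split; lra. Qed.

Lemma le_eql (R : realType) (x y z : R) : x = y -> y <= z -> x <= z.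
Proof. by move->. Qed.

Unset Implicit Arguments.

Theorem theorem1 (R : realType) (n p : nat) (n_gt0 : (0 < n)%N) (p_gt0 : (0 < p)%N)
  (* network *)
  (W : 'M[R]_n)
  (W_stoch : doubly_stochastic W)
  (W_conn : strongly_connected (comm_graph W))
  (* objective *)
  (f : 'I_n -> 'rV[R]_p -> R) (mu : R) (L_ : 'I_n -> R) (xstar : 'rV[R]_p)
  (f_diff : forall i x, differentiable (f i) x)
  (mu_gt0 : 0 < mu)
  (f_convex : strongly_convex mu (average f))
  (f_lip : forall i, lipschitz_grad (L_ i) (f i))
  (xstar_min : unique_minimizer (average f) xstar)
  (* compression *)
  (C r delta : R)
  (C_ge0 : 0 <= C) (r_gt0 : 0 < r) (delta_gt0 : 0 < delta) (delta_le1 : delta <= 1)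
  (d d' : measure_display) (Omega : measurableType d) (P : probability Omega R)
  (Xi : measurableType d') (nu : probability Xi R)
  (cop : Xi -> 'rV[R]_p -> 'rV[R]_p)
  (cop_compr : compressor nu C r delta cop)
  (xi : (bool * nat * 'I_n)%type -> {RV P >-> Xi})
  (xi_iid : iid nu xi)
  (* algorithm parameters *)
  (X0 Hx0 Hy0 : 'M[R]_(n, p)) (alphax alphay gamma eta : R)
  (alphax_gt0 : 0 < alphax) (alphax_le : alphax <= r^-1)
  (alphay_gt0 : 0 < alphay) (alphay_le : alphay <= r^-1)
  (* constants *)
  (taux tauy : R) (taux_gt1 : 1 < taux) (tauy_gt1 : 1 < tauy)
  (eps1 eps2 eps3 eps4 eps5 : R) :
  let L := \big[Num.max/0]_i L_ i in
  let kappa := L / mu in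
  let s := 1 - spectral_norm (W - n%:R^-1 *: const_mx 1) in
  let rhot := 1 - gamma * s in
  let nIW := spectral_norm (1%:M - W) in
  let cx := taux * (1 - alphax * r * delta) in
  let cy := tauy * (1 - alphay * r * delta) in
  let tx := 3 * taux / (taux - 1) in
  let ty := 3 * tauy / (tauy - 1) in
  let c1 := 2 / s in
  let c2 := 2 * C / s * nIW ^+ 2 in
  let c3 := 12 * L ^+ 2 / s in
  let c4 := 6 / s * nIW ^+ 2 in
  let c5 := tx * nIW ^+ 2 in
  let c6 := tx * C * nIW ^+ 2 in
  let c7 := ty * C * nIW ^+ 2 in
  let c8 := ty * nIW ^+ 2 in
  let m2 := c4 * eps2 + c2 * (3 * eps4 + eps5) in
  let m3 := tx * (2 * n%:R * eps1 + 2 * eps2 + eps3) + c5 * eps2 + c6 * eps4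
            + eps4 / (2 * kappa) in
  let m4 := 3 * ty * (2 * n%:R * eps1 + 2 * eps2 + eps3) + 3 * c8 * eps2
            + c8 * eps3 + 3 * c7 * eps4 + c7 * eps5 + eps5 / (2 * kappa) in
  let A : 'M[R]_5 := mx_of_rows 5 5
    [:: [:: 1 - 3 / 2 * eta * mu;
            3 * eta * L ^+ 2 / (mu * n%:R);
            0;
            0;
            0];
        [:: 0;
            (1 + rhot ^+ 2) / 2;
            c1 * (eta ^+ 2 / gamma);
            c2 * gamma;
            0];
        [:: n%:R * c3 * L ^+ 2 * (eta ^+ 2 / gamma);
            c3 * L ^+ 2 * (eta ^+ 2 / gamma) + c4 * L ^+ 2 * gamma;
            (1 + rhot ^+ 2) / 2 + 1 / 2 * c3 * (eta ^+ 2 / gamma);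
            3 * c2 * L ^+ 2 * gamma;
            c2 * gamma];
        [:: 2 * n%:R * tx * L ^+ 2 * eta ^+ 2;
            c5 * gamma ^+ 2 + 2 * tx * L ^+ 2 * eta ^+ 2;
            tx * eta ^+ 2;
            cx + c6 * gamma ^+ 2;
            0];
        [:: 6 * n%:R * ty * L ^+ 4 * eta ^+ 2;
            3 * c8 * L ^+ 2 * gamma ^+ 2 + 6 * ty * L ^+ 4 * eta ^+ 2;
            3 * ty * L ^+ 2 * eta ^+ 2 + c8 * gamma ^+ 2;
            3 * c7 * L ^+ 2 * gamma ^+ 2;
            cy + c7 * gamma ^+ 2]] in
  let X k w := st_X (cgt f W cop alphax alphay gamma eta
                         (fun i => xi i : Omega -> Xi) X0 Hx0 Hy0 k w) in
  let Omega_o k := ('E_P[fun w => (frob (row_mean (X k w) - xstar) ^+ 2)%R])%E in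
  let Omega_c k := ('E_P[fun w => (frob (deviation (X k w)) ^+ 2)%R])%E in
  let rate := 1 - 1 / 2 * eta * mu in
  cx < 1 -> cy < 1 ->
  0 < eps1 -> 0 < eps2 -> 0 < eps3 -> 0 < eps4 -> 0 < eps5 ->
  3 * kappa ^+ 2 * eps2 <= n%:R * eps1 ->
  2 * c1 * c2 * eps4 <= eps2 ->
  4 * m2 / s <= eps3 ->
  0 < gamma ->
  gamma <= Num.min 1 (Num.min ((1 - cx) / m3 * eps4) ((1 - cy) / m4 * eps5)) ->
  0 < eta ->
  eta <= Num.min (s * eps2 / (4 * kappa * eps3) * (gamma / L))
                 (s * eps3 / (12 * kappa * (2 * n%:R * eps1 + 2 * eps2 + eps3))
                  * (gamma / L)) ->
  [/\ spectral_radius A <= rate,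
      Omega_o k @[k --> \oo] --> 0%E,
      Omega_c k @[k --> \oo] --> 0%E,
      exists M : R, forall k, (Omega_o k <= (M * rate ^+ k)%:E)%E &
      exists M : R, forall k, (Omega_c k <= (M * rate ^+ k)%:E)%E].
Proof.
move=> L kappa s rhot nIW cx cy tx ty c1 c2 c3 c4 c5 c6 c7 c8 m2 m3 m4 A X.
move=> Omega_o Omega_c rate cx1 cy1 eps1_gt0 eps2_gt0 eps3_gt0 eps4_gt0 eps5_gt0.
move=> eps_12 eps_24 eps_3 gamma_gt0.
rewrite le_min => /andP[gamma_le1]; rewrite le_min => /andP[gamma_m3 gamma_m4].
move=> eta_gt0; rewrite le_min => /andP[eta_le1 eta_le2].
(* The maximum defining [L] starts from 0, so [L] is nonnegative even when some of the
   constants [L_ i] are negative, and all the gradients are [L]-Lipschitz. *)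
have L_ge0 : 0 <= L by exact: bigmax_ge_id.
have f_lipL i : lipschitz_grad L (f i).
  move=> x y; apply: (le_trans (f_lip i x y)); apply: ler_wpM2r; first exact: frob_ge0.
  exact: le_bigmax.
have lipL := grad_average_lip f_diff f_lipL n_gt0.
have mu_le_L : mu <= L := strongly_convex_le_lip f_convex lipL p_gt0.
have L_gt0 : 0 < L := lt_le_trans mu_gt0 mu_le_L.
have s_le1 : s <= 1 by rewrite gerBl spectral_norm_ge0.
have n0 : 0 < n%:R :> R by rewrite ltr0n.
have L_kappa : L = kappa * mu by rewrite /kappa divfK// lt0r_neq0.
have kappa_gt0 : 0 < kappa by rewrite divr_gt0.
have s_gt0 : 0 < s := spectral_gap_gt0 mu_gt0 mu_le_L gamma_gt0 L_kappa eta_gt0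
  eps2_gt0 eps3_gt0 eta_le1.
have etamu := etamu_le12 n0 mu_gt0 L_ge0 mu_le_L s_le1 gamma_gt0 gamma_le1 L_kappa
  eta_gt0 eps1_gt0 eps2_gt0 eps3_gt0 eta_le1 eta_le2.
have etaL := eta2L2_le n0 mu_gt0 mu_le_L s_le1 gamma_gt0 gamma_le1 L_kappa
  eta_gt0 eps1_gt0 eps2_gt0 eps3_gt0 eta_le1 eta_le2.
have etamu0 : 0 < eta * mu by rewrite mulr_gt0.
have nIW_ge0 : 0 <= nIW := spectral_norm_ge0 _.
have tx_ge0 : 0 <= tx.
  have : 0 < taux - 1 by rewrite subr_gt0.
  have : 0 <= taux by rewrite ltW// (lt_trans _ taux_gt1).
  by rewrite /tx => t0 t1; nonneg.
have ty_ge0 : 0 <= ty.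
  have : 0 < tauy - 1 by rewrite subr_gt0.
  have : 0 <= tauy by rewrite ltW// (lt_trans _ tauy_gt1).
  by rewrite /ty => t0 t1; nonneg.
have c1_ge0 : 0 <= c1 by rewrite /c1; nonneg.
have c2_ge0 : 0 <= c2 by rewrite /c2; nonneg.
have c3_ge0 : 0 <= c3 by rewrite /c3; nonneg.
have c4_ge0 : 0 <= c4 by rewrite /c4; nonneg.
have c5_ge0 : 0 <= c5 by rewrite /c5; nonneg.
have c6_ge0 : 0 <= c6 by rewrite /c6; nonneg.
have c7_ge0 : 0 <= c7 by rewrite /c7; nonneg.
have c8_ge0 : 0 <= c8 by rewrite /c8; nonneg.
have alphax_r : 0 <= alphax * r <= 1.
  by apply/andP; split; [rewrite mulr_ge0// ltW|rewrite -ler_pdivlMr// mul1r].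
have alphay_r : 0 <= alphay * r <= 1.
  by apply/andP; split; [rewrite mulr_ge0// ltW|rewrite -ler_pdivlMr// mul1r].
have ad_ge0 a : 0 <= a * r <= 1 -> 0 <= 1 - a * r * delta.
  move=> /andP[a0 a1]; rewrite subr_ge0 -[leRHS]mulr1.
  by apply: ler_pM => //; exact: ltW.
have cx_ge0 : 0 <= cx.
  by rewrite mulr_ge0 ?ad_ge0// ltW// (lt_trans _ taux_gt1).
have cy_ge0 : 0 <= cy.
  by rewrite mulr_ge0 ?ad_ge0// ltW// (lt_trans _ tauy_gt1).
have [diag_ge0 rate_ge0 rate_lt1] := rate_bounds etamu0 etamu.
have row1 := row_optimality n0 mu_gt0 L_kappa eta_gt0 eps_12.
have row2 := row_consensus n0 mu_gt0 L_ge0 mu_le_L s_le1 gamma_gt0 gamma_le1 L_kappa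
  eta_gt0 eps1_gt0 eps2_gt0 eps3_gt0 eta_le1 eta_le2 eps_24.
have row3 := row_tracking n0 mu_gt0 L_ge0 mu_le_L s_le1 gamma_gt0 gamma_le1 L_kappa
  eta_gt0 eps1_gt0 eps2_gt0 eps3_gt0 eta_le1 eta_le2 eps_3.
have row4 := row_compression n0 mu_gt0 L_ge0 mu_le_L s_le1 gamma_gt0 gamma_le1 L_kappa
  eta_gt0 eps1_gt0 eps2_gt0 eps3_gt0 eps4_gt0 eta_le2 tx_ge0 c5_ge0 c6_ge0 gamma_m3.
have row5 := row_tracking_compression n0 mu_gt0 L_ge0 mu_le_L s_le1 gamma_gt0 gamma_le1
  L_kappa eta_gt0 eps1_gt0 eps2_gt0 eps3_gt0 eps4_gt0 eps5_gt0 eta_le2 ty_ge0 c7_ge0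
  c8_ge0 gamma_m4.
have s0 : s != 0 by rewrite gt_eqF.
have g0 : gamma != 0 by rewrite gt_eqF.
have rad : spectral_radius A <= rate.
  pose v (i : 'I_5) := [:: eps1; eps2; L ^+ 2 * eps3; eps4; L ^+ 2 * eps5]`_i.
  apply: (@spectral_radius_le _ _ A v) => //.
  - case=> [[|[|[|[|[|//]]]]] ?]; case=> [[|[|[|[|[|//]]]]] ?]; rewrite mxE //=;
      nonneg.
  - by case=> [[|[|[|[|[|//]]]]] ?]; rewrite /v //= mulr_gt0// exprn_gt0.
  - case=> [[|[|[|[|[|//]]]]] ?]; rewrite !big_ord_recl big_ord0 !mxE /v /= /bump /=.
    + by apply: (le_eql _ row1); ring.
    + by apply: (le_eql _ row2); rewrite /c1 /rhot; ring.
    + by apply: (le_eql _ row3); rewrite /c3 /rhot; field; rewrite s0 g0.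
    + by apply: (le_eql _ row4); ring.
    + by apply: (le_eql _ row5); ring.
have grad_xstar : grad (average f) xstar = 0.
  apply: grad_at_min; first exact: differentiable_average.
  by have : [set xstar] xstar by []; rewrite -xstar_min.
have L2_gt0 : 0 < L ^+ 2 by rewrite exprn_gt0.
have taux1 : taux - 1 != 0 by rewrite subr_eq0 gt_eqF.
have tauy1 : tauy - 1 != 0 by rewrite subr_eq0 gt_eqF.
(* Rows 2 to 5 once more, with the bound on the displacement of [X] not distributed. *)
have [||||M M0 decay] := moments_decay n_gt0 W_stoch f_diff mu_gt0 L_ge0 f_convex f_lipL
  grad_xstar C_ge0 r_gt0 delta_le1 cop_compr xi_iid X0 Hx0 Hy0 alphax_r alphay_r
  taux_gt1 tauy_gt1 s_gt0 gamma_gt0 gamma_le1 eta_gt0 etaL etamu rate_ge0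
  eps1_gt0 eps2_gt0 (mulr_gt0 L2_gt0 eps3_gt0) eps4_gt0 (mulr_gt0 L2_gt0 eps5_gt0) row1.
- by apply: (le_eql _ row2); rewrite -/s -/nIW /c2 /nIW; field; rewrite ?s0.
- by apply: (le_eql _ row3); rewrite -/s -/nIW /c2 /c4 /nIW; field; rewrite ?s0 ?g0.
- by apply: (le_eql _ row4); rewrite -/s -/nIW /cx /c5 /c6 /tx /nIW; field; rewrite ?taux1.
- by apply: (le_eql _ row5); rewrite -/s -/nIW /cy /c7 /c8 /ty /nIW; field; rewrite ?tauy1.
have Eo k : (Omega_o k <= (M * eps1 * rate ^+ k)%:E)%E.
  by have [[_ _ H] _ _ _ _] := decay k; rewrite mulrAC.
have Ec k : (Omega_c k <= (M * eps2 * rate ^+ k)%:E)%E.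
  by have [_ [_ _ H] _ _ _] := decay k; rewrite mulrAC.
have rate01 : 0 <= rate < 1 by rewrite rate_ge0.
split => //; [| |by exists (M * eps1)|by exists (M * eps2)].
- apply: (cvge_geometric_bound _ Eo rate01) => k.
  by apply: expectation_ge0 => w; exact: sqr_ge0.
- apply: (cvge_geometric_bound _ Ec rate01) => k.
  by apply: expectation_ge0 => w; exact: sqr_ge0.
Qed.
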